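(* Let $\mathbb{R}^6$ have coordinates $(x_1,y_1,x_2,y_2,x_3,y_3)$, with indices of $x_i,y_i$ taken modulo $3$, let $$Z_i=(x_{i+1}-x_i)\,\partial_{x_i}+(y_{i+1}-y_i)\,\partial_{y_i},\qquad i=1,2,3,$$ and let $\mathcal{D}=\mathrm{Span}(Z_1,Z_2,Z_3)$, considered on the open set of $\mathbb{R}^6$ where the points $(x_1,y_1),(x_2,y_2),(x_3,y_3)$ are not collinear. Then the Lie algebra of all (local infinitesimal) symmetries of $\mathcal{D}$ is isomorphic to $\mathfrak{sl}(3,\mathbb{R})$. More precisely, on every nonempty connected open subset $U$ of this open set the Lie algebra of symmetries of $\mathcal{D}|_U$ is isomorphic to $\mathfrak{sl}(3,\mathbb{R})$ and has as a basis (the restrictions to $U$ of) the following $8$ vector fields: $$\begin{aligned} X_1&=\partial_{x_1}+\partial_{x_2}+\partial_{x_3},\qquad X_2=\partial_{y_1}+\partial_{y_2}+\partial_{y_3},\\ X_3&=y_1\partial_{x_1}+y_2\partial_{x_2}+y_3\partial_{x_3},\qquad X_4=x_1\partial_{y_1}+x_2\partial_{y_2}+x_3\partial_{y_3},\\ X_5&=x_1\partial_{x_1}+x_2\partial_{x_2}+x_3\partial_{x_3},\qquad X_6=y_1\partial_{y_1}+y_2\partial_{y_2}+y_3\partial_{y_3},\\ X_7&=x_1y_1\partial_{x_1}+x_2y_2\partial_{x_2}+x_3y_3\partial_{x_3}+y_1^2\partial_{y_1}+y_2^2\partial_{y_2}+y_3^2\partial_{y_3},\\ X_8&=x_1^2\partial_{x_1}+x_2^2\partial_{x_2}+x_3^2\partial_{x_3}+x_1y_1\partial_{y_1}+x_2y_2\partial_{y_2}+x_3y_3\partial_{y_3}.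 \end{aligned}$$
   Context: A point of $\mathbb{R}^6$ encodes three points (''ants'') $\vec r_i=(x_i,y_i)$ in the plane; $\mathcal{D}$ is the velocity distribution of the rule ''the velocity $\dot{\vec r}_i$ is aligned with $\vec r_{i+1}-\vec r_i$'' (Rule A). On the set of non-collinear configurations $\mathcal{D}$ has growth vector $(3,6)$. An (infinitesimal) symmetry of a distribution $\mathcal{D}$ on a manifold $U$ is a smooth vector field $X$ on $U$ such that $[X,Z]\in\Gamma(\mathcal{D})$ for every $Z\in\Gamma(\mathcal{D})$; the symmetries form a Lie algebra under the commutator of vector fields. *)

(* Defs.v *)
From HB Require Import structures.
From mathcomp Require Import all_boot all_order all_algebra.
From mathcomp Require Import all_classical all_reals all_analysis.

Set Implicit Arguments.
Unset Strict Implicit.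
Unset Printing Implicit Defensive.

Import Order.TTheory GRing.Theory Num.Theory.
Import numFieldNormedType.Exports.

Local Open Scope classical_set_scope.
Local Open Scope ring_scope.

(* A Lie algebra over R is given by a subset L of an ambient R-module V and a
   bracket br : V -> V -> V, of which only the values on L matter. *)

Definition is_lie_algebra (R : fieldType) (V : lmodType R)
    (L : set V) (br : V -> V -> V) : Prop :=
  [/\ L 0 /\ (forall (a : R) (u v : V), L u -> L v -> L (a *: u + v)),
      forall u v : V, L u -> L v -> L (br u v),
      forall (a : R) (u v w : V), L u -> L v -> L w ->
        br (a *: u + v) w = a *: br u w + br v w /\
        br w (a *: u + v) = a *: br w u + br w v,
      forall u : V, L u -> br u u = 0 &
      forall u v w : V, L u -> L v -> L w ->
        br u (br v w) + br v (br w u) + br w (br u v) = 0].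

Definition lie_isomorphic (R : fieldType) (V W : lmodType R)
    (L : set V) (brL : V -> V -> V) (M : set W) (brM : W -> W -> W) : Prop :=
  exists phi : V -> W,
    [/\ set_bij L M phi,
        forall (a : R) (u v : V), L u -> L v ->
          phi (a *: u + v) = a *: phi u + phi v &
        forall u v : V, L u -> L v -> phi (brL u v) = brM (phi u) (phi v)].

Definition is_basis (R : fieldType) (V : lmodType R) (L : set V)
    (m : nat) (e : 'I_m -> V) : Prop :=
  [/\ forall k, L (e k),
      forall c : 'I_m -> R, \sum_k c k *: e k = 0 -> forall k, c k = 0 &
      forall v : V, L v -> exists c : 'I_m -> R, v = \sum_k c k *: e k].

Definition sl (R : fieldType) (n : nat) : set 'M[R]_n := [set A | \tr A = 0].

Definition mx_bracket (R : fieldType) (n : nat) (A B : 'M[R]_n) : 'M[R]_n :=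
  A *m B - B *m A.

Definition pderiv (R : realType) (n : nat) (i : 'I_n.+1)
    (f : 'rV[R]_n.+1 -> R) : 'rV[R]_n.+1 -> R :=
  fun p => 'D_(delta_mx 0 i) f p.

Fixpoint class_C (R : realType) (n : nat) (k : nat) (U : set 'rV[R]_n.+1)
    (f : 'rV[R]_n.+1 -> R) : Prop :=
  (forall p, U p -> {for p, continuous f}) /\
  match k with
  | 0 => True
  | k'.+1 => forall i : 'I_n.+1,
      (forall p, U p -> derivable f p (delta_mx 0 i)) /\
      class_C k' U (pderiv i f)
  end.

Definition smooth_on (R : realType) (n : nat) (U : set 'rV[R]_n.+1)
    (f : 'rV[R]_n.+1 -> R) : Prop :=
  forall k, class_C k U f.

(* A vector field on the open set U is encoded by its components
   X p = (X^1(p), ..., X^n(p)), extended by 0 outside U, so that equality of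
   vector fields on U is equality of functions.  Derivatives at points of U
   do not depend on this extension. *)

Definition vf_restrict (R : realType) (n : nat) (U : set 'rV[R]_n.+1)
    (X : 'rV[R]_n.+1 -> 'rV[R]_n.+1) : 'rV[R]_n.+1 -> 'rV[R]_n.+1 :=
  patch (fun=> 0) U X.

Definition vector_field (R : realType) (n : nat) (U : set 'rV[R]_n.+1) :
    set ('rV[R]_n.+1 -> 'rV[R]_n.+1) :=
  [set X | (forall j, smooth_on U (fun p => X p 0 j)) /\
           (forall p, ~ U p -> X p = 0)].

(* [X, Y]^j = \sum_i (X^i d_i Y^j - Y^i d_i X^j) on U *)
Definition vf_bracket (R : realType) (n : nat) (U : set 'rV[R]_n.+1)
    (X Y : 'rV[R]_n.+1 -> 'rV[R]_n.+1) : 'rV[R]_n.+1 -> 'rV[R]_n.+1 :=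
  vf_restrict U (fun p => \row_j \sum_i
    (X p 0 i * pderiv i (fun q => Y q 0 j) p -
     Y p 0 i * pderiv i (fun q => X q 0 j) p)).

(* A distribution is given by matrices D p whose row space is its fibre at p. *)
Definition dist_section (R : realType) (n m : nat) (U : set 'rV[R]_n.+1)
    (D : 'rV[R]_n.+1 -> 'M[R]_(m, n.+1)) :
    set ('rV[R]_n.+1 -> 'rV[R]_n.+1) :=
  [set Z | vector_field U Z /\ (forall p, U p -> (Z p <= D p)%MS)].

Definition symmetries (R : realType) (n m : nat) (U : set 'rV[R]_n.+1)
    (D : 'rV[R]_n.+1 -> 'M[R]_(m, n.+1)) :
    set ('rV[R]_n.+1 -> 'rV[R]_n.+1) :=
  [set X | vector_field U X /\
           (forall Z, dist_section U D Z -> dist_section U D (vf_bracket U X Z))].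

(* The coordinates of R^6 are (x_1, y_1, x_2, y_2, x_3, y_3); the ants are
   numbered 0, 1, 2, with cyclic successor ordS. *)

Definition xidx (i : 'I_3) : 'I_6 := inord (2 * i)%N.
Definition yidx (i : 'I_3) : 'I_6 := inord (2 * i + 1)%N.

Definition xc (R : realType) (i : 'I_3) (p : 'rV[R]_6) : R := p 0 (xidx i).
Definition yc (R : realType) (i : 'I_3) (p : 'rV[R]_6) : R := p 0 (yidx i).

Definition dx (R : realType) (i : 'I_3) : 'rV[R]_6 := delta_mx 0 (xidx i).
Definition dy (R : realType) (i : 'I_3) : 'rV[R]_6 := delta_mx 0 (yidx i).
Arguments dx {R} i.
Arguments dy {R} i.

Definition collinear (R : realType) (p : 'rV[R]_6) : Prop :=
  exists a b c : R, (a, b) <> (0, 0) /\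
    forall i : 'I_3, a * xc i p + b * yc i p = c.

Definition antZ (R : realType) (i : 'I_3) (p : 'rV[R]_6) : 'rV[R]_6 :=
  (xc (ordS i) p - xc i p) *: dx i + (yc (ordS i) p - yc i p) *: dy i.

Definition antD (R : realType) (p : 'rV[R]_6) : 'M[R]_(3, 6) :=
  \matrix_(i < 3) antZ i p.

Definition antX1 (R : realType) (p : 'rV[R]_6) : 'rV[R]_6 := \sum_i dx i.
Definition antX2 (R : realType) (p : 'rV[R]_6) : 'rV[R]_6 := \sum_i dy i.
Definition antX3 (R : realType) (p : 'rV[R]_6) : 'rV[R]_6 :=
  \sum_i yc i p *: dx i.
Definition antX4 (R : realType) (p : 'rV[R]_6) : 'rV[R]_6 :=
  \sum_i xc i p *: dy i.
Definition antX5 (R : realType) (p : 'rV[R]_6) : 'rV[R]_6 :=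
  \sum_i xc i p *: dx i.
Definition antX6 (R : realType) (p : 'rV[R]_6) : 'rV[R]_6 :=
  \sum_i yc i p *: dy i.
Definition antX7 (R : realType) (p : 'rV[R]_6) : 'rV[R]_6 :=
  \sum_i (xc i p * yc i p) *: dx i + \sum_i yc i p ^+ 2 *: dy i.
Definition antX8 (R : realType) (p : 'rV[R]_6) : 'rV[R]_6 :=
  \sum_i xc i p ^+ 2 *: dx i + \sum_i (xc i p * yc i p) *: dy i.

Definition antX (R : realType) (k : 'I_8) : 'rV[R]_6 -> 'rV[R]_6 :=
  tnth [tuple @antX1 R; @antX2 R; @antX3 R; @antX4 R;
              @antX5 R; @antX6 R; @antX7 R; @antX8 R] k.
Arguments antX {R} k.

(* Main.v *)
(** A symmetry [X] of the distribution is written in the frame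
    [Z_i = d_i . grad_i], [W_i = d_(i+1) . grad_i], with [d_i = r_(i+1) - r_i], as
    [X = sum_i alpha_i Z_i + beta_i W_i].  This frame spans a Lie algebra with
    constant structure constants (that of the affine group, acting simply
    transitively on triangles), so the symmetry condition becomes a linear system
    with constant coefficients on [alpha] and [beta].  Its compatibility conditions
    show that [[X, Z_i] = - t_i Z_i] with [t_1 + t_2 + t_3 = 0], which closes the
    system on the eight unknowns [alpha_i, beta_i, t_i].

    Let [P] be the matrix whose rows are the homogeneous coordinates
    [(x_i, y_i, 1)].  The eight unknowns are the entries of a traceless matrix [B]
    such that [P^-1 B P] has vanishing derivatives; it is therefore a constant
    matrix [A], and [X] is the projective vector field of [A] applied to each of
    the three points.  Conversely projective vector fields map lines to lines, so
    they are symmetries, and [A |-> X] is a morphism of Lie algebras. *)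

Require Import Defs.
From HB Require Import structures.
From mathcomp Require Import all_boot all_order all_algebra.
From mathcomp Require Import all_classical all_reals all_analysis.
From mathcomp Require Import ring lra.
Import Order.TTheory GRing.Theory Num.Theory.
Import numFieldNormedType.Exports.
Local Open Scope classical_set_scope.
Local Open Scope ring_scope.

Set Implicit Arguments.
Unset Strict Implicit.
Unset Printing Implicit Defensive.

(** * The constant-coefficient system *)

(* [Z] and [W] satisfy the bracket relations of the frame of a triangle, [s] being
   the cyclic successor; [Zb0]-[Zb2] say that [sum_i alpha_i Z_i + beta_i W_i] is a
   symmetry.  The evaluations [ev] reduce linear reasoning in [V] to reasoning in
   an ordered field. *)
Section TriangleModule.
Variables (R : realFieldType) (V : zmodType) (T : Type) (ev : T -> {additive V -> R}).
Hypothesis ev_inj : forall u v : V, (forall p, ev p u = ev p v) -> u = v.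
Variables (I : Type) (s : I -> I).
Hypothesis s3 : forall i, s (s (s i)) = i.
Variables Z W : I -> {additive V -> V}.
Hypothesis ZZ : forall i v, Z i (Z (s i) v) - Z (s i) (Z i v) = - W i v.
Hypothesis ZW0 : forall i v, Z i (W i v) - W i (Z i v) = W i v.
Hypothesis ZW1 : forall i v, Z (s i) (W i v) - W i (Z (s i) v) = - W i v.
Hypothesis ZW2 : forall i v, Z (s (s i)) (W i v) - W i (Z (s (s i)) v) =
  - Z i v - W i v + W (s (s i)) v + Z (s (s i)) v.
Variables alpha beta : I -> V.
Hypothesis Zb0 : forall i, Z i (beta i) = alpha (s i) - beta i - beta (s i).
Hypothesis Zb1 : forall i, Z i (beta (s i)) = beta (s i).
Hypothesis Zb2 : forall i, Z i (beta (s (s i))) = beta (s (s i)) - alpha (s (s i)).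

Let ZD i := (raddfD (Z i), raddfB (Z i), raddfN (Z i), raddf0 (Z i)).
Let WD i := (raddfD (W i), raddfB (W i), raddfN (W i), raddf0 (W i)).
Let eD x := (raddfD (ev x), raddfB (ev x), raddfN (ev x), raddf0 (ev x)).

Ltac lin := intros; apply: ev_inj; let x := fresh "x" in intro x;
  repeat match goal with H : @eq _ _ _ |- _ =>
    apply (f_equal (ev x)) in H; rewrite ?(eD x) in H; revert H end;
  rewrite ?(eD x); intros; lra.

(* [t i], [p i], [q i] are the coefficients of [[Z i, X]] on [Z i], [Z (s i)],
   [Z (s (s i))]. *)
Variables t p q : I -> V.
Hypothesis Za0 : forall i, Z i (alpha i) = t i - beta (s i).
Hypothesis Za1 : forall i, Z i (alpha (s i)) = p i + beta (s i).
Hypothesis Za2 : forall i, Z i (alpha (s (s i))) = q i.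

Let Wdef i v : W i v = Z (s i) (Z i v) - Z i (Z (s i) v).
Proof. by rewrite -opprB ZZ opprK. Qed.

Let Zb1' i : Z (s (s i)) (beta i) = beta i.
Proof. by have := Zb1 (s (s i)); rewrite s3. Qed.
Let Zb2' i : Z (s i) (beta i) = beta i - alpha i.
Proof. by have := Zb2 (s i); rewrite s3. Qed.
Let Za1' i : Z (s (s i)) (alpha i) = p (s (s i)) + beta i.
Proof. by have := Za1 (s (s i)); rewrite s3. Qed.
Let Za2' i : Z (s i) (alpha i) = q (s i).
Proof. by have := Za2 (s i); rewrite s3. Qed.

Ltac der := rewrite ?(ZD, WD, Zb0, Zb1, Zb2, Zb1', Zb2', Za0, Za1, Za2, Za1',
  Za2', s3).

Let Wb0 i : W i (beta i) =
  t i + t (s i) + alpha i - alpha (s i) - alpha (s (s i)) + beta (s i).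
Proof. by rewrite Wdef; do 3 der; lin. Qed.
Let Wb1 i : W (s i) (beta i) = alpha i - beta i - p (s (s i)).
Proof. by rewrite Wdef; do 3 der; lin. Qed.
Let Wb2 i : W (s (s i)) (beta i) = - q (s (s i)).
Proof. rewrite Wdef; do 3 der; lin. Qed.
Let Wb1' i : W i (beta (s (s i))) = alpha (s (s i)) - beta (s (s i)) - p (s i).
Proof. by have := Wb1 (s (s i)); rewrite s3. Qed.
Let Wb2' i : W i (beta (s i)) = - q i.
Proof. by have := Wb2 (s i); rewrite s3. Qed.
Let Wa0 i : W i (alpha i) = Z (s i) (t i) - Z (s i) (beta (s i)) - Z i (q (s i)).
Proof. rewrite Wdef; do 2 der; lin. Qed.
Let Wa1 i : W i (alpha (s i)) =
  Z (s i) (p i) + Z (s i) (beta (s i)) - Z i (t (s i)) + Z i (beta (s (s i))).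
Proof. rewrite Wdef; do 2 der; lin. Qed.
Let Wa2 i : W i (alpha (s (s i))) =
  Z (s i) (q i) - Z i (p (s i)) - Z i (beta (s (s i))).
Proof. rewrite Wdef; do 2 der; lin. Qed.
Let Wa1' i : W (s (s i)) (alpha i) =
  Z i (p (s (s i))) + Z i (beta i) - Z (s (s i)) (t i) + Z (s (s i)) (beta (s i)).
Proof. by have := Wa1 (s (s i)); rewrite s3. Qed.
Let Wa2' i : W (s i) (alpha i) =
  Z (s (s i)) (q (s i)) - Z (s i) (p (s (s i))) - Z (s i) (beta i).
Proof. by have := Wa2 (s i); rewrite s3. Qed.

Ltac simp := rewrite ?(ZD, WD, s3, Zb0, Zb1, Zb2, Zb1', Zb2', Za0, Za1, Za2,
  Za1', Za2', Wb0, Wb1, Wb2, Wb1', Wb2', Wa0, Wa1, Wa2, Wa1', Wa2').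

Let Zp0 i : Z i (p i) = p i.
Proof. by have := ZW1 (s (s i)) (beta (s i)); do 2 simp; lin. Qed.

Let Zq0 i : Z i (q i) = q i + q i.
Proof. by have := ZW0 i (beta (s i)); do 2 simp; lin. Qed.

Let Zp2_Zq1 i : Z (s (s i)) (p i) = p i /\ Z (s i) (q i) = - q i.
Proof.
have H j : Z (s j) (p (s (s j))) = p (s (s j)) /\ Z (s (s j)) (q (s j)) = - q (s j).
  have := ZW0 (s j) (beta j); have := ZW1 (s j) (beta (s (s j))); do 2 simp.
  by split; lin.
by have [+ _] := H (s i); have [_] := H (s (s i)); rewrite !s3.
Qed.

Let Zt_all i : [/\ Z i (t (s i)) = q i - p i,
  Z i (t (s (s i))) = t i - q i,
  Z (s i) (p i) = Z i (t i) + t i - p i - p i - p i &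
  Z (s (s i)) (q i) = Z i (t i) + t i - p i - q i].
Proof.
have := ZW2 (s i) (beta (s i)); have := ZW2 i (beta (s i)).
have := ZW0 i (beta i); have := ZW1 (s (s i)) (beta (s (s i))).
by do 2 simp; split; lin.
Qed.
Let Zt1 i : Z i (t (s i)) = q i - p i. Proof. by case: (Zt_all i). Qed.
Let Zt2 i : Z i (t (s (s i))) = t i - q i. Proof. by case: (Zt_all i). Qed.
Let Zp1 i : Z (s i) (p i) = Z i (t i) + t i - p i - p i - p i.
Proof. by case: (Zt_all i). Qed.
Let Zp2 i : Z (s (s i)) (p i) = p i. Proof. by case: (Zp2_Zq1 i). Qed.
Let Zq1 i : Z (s i) (q i) = - q i. Proof. by case: (Zp2_Zq1 i). Qed.
Let Zq2 i : Z (s (s i)) (q i) = Z i (t i) + t i - p i - q i.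
Proof. by case: (Zt_all i). Qed.
Let Zt1' i : Z (s (s i)) (t i) = q (s (s i)) - p (s (s i)).
Proof. by have := Zt1 (s (s i)); rewrite s3. Qed.
Let Zt2' i : Z (s i) (t i) = t (s i) - q (s i).
Proof. by have := Zt2 (s i); rewrite s3. Qed.
Let Zp1' i : Z i (p (s (s i))) =
  Z (s (s i)) (t (s (s i))) + t (s (s i)) - p (s (s i)) - p (s (s i)) - p (s (s i)).
Proof. by have := Zp1 (s (s i)); rewrite s3. Qed.
Let Zp2' i : Z i (p (s i)) = p (s i). Proof. by have := Zp2 (s i); rewrite s3. Qed.
Let Zq1' i : Z i (q (s (s i))) = - q (s (s i)).
Proof. by have := Zq1 (s (s i)); rewrite s3. Qed.
Let Zq2' i : Z i (q (s i)) = Z (s i) (t (s i)) + t (s i) - p (s i) - q (s i).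
Proof. by have := Zq2 (s i); rewrite s3. Qed.

Ltac simpt := rewrite ?(ZD, WD, s3, Zt1, Zt2, Zt1', Zt2', Zp0, Zp1, Zp2, Zp1',
  Zp2', Zq0, Zq1, Zq2, Zq1', Zq2').

Let Wt1 i : W (s i) (t i) =
  q (s i) + p (s (s i)) + p (s (s i)) - Z (s (s i)) (t (s (s i))).
Proof. by rewrite Wdef; do 2 simpt; lin. Qed.

Let ZZt0 i : Z i (Z i (t i)) + Z i (Z i (t i)) = t i + t i + p i + p i + p i.
Proof.
have := ZW1 (s (s i)) (t (s i)); rewrite !s3 !Wt1; simpt.
by rewrite !Wdef; do 2 simpt; lin.
Qed.

Let p_eq0 i : p i = 0.
Proof.
have := ZW0 i (p i); have := ZZt0 i; have := congr1 (Z i) (ZZt0 i).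
by rewrite !Wdef; do 3 simpt; lin.
Qed.

Let Zt0 i : Z i (t i) = - t i.
Proof. by have := Zp1 i; rewrite !p_eq0 raddf0; lin. Qed.

Let q_eq0 i : q i = 0.
Proof.
have Zq2N : Z (s (s i)) (q i) = - q i.
  by rewrite Zq2 Zt0 p_eq0; lin.
have := ZW2 i (q i); rewrite !Wdef !s3 !Zq2N !ZD !Zq0 !Zq1 !ZD !Zq2N !Zq1 !Zq0.
by lin.
Qed.

Let t_sum i : t i + t (s i) + t (s (s i)) = 0.
Proof.
have := ZW2 i (t i); rewrite !Wdef; do 3 (simpt; rewrite ?(Zt0, p_eq0, q_eq0, ZD)).
by lin.
Qed.
Lemma triangle_system i :
  [/\ Z i (alpha (s i)) = beta (s i), Z i (alpha (s (s i))) = 0,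
      Z i (t i) = - t i, Z i (t (s i)) = 0 & Z i (t (s (s i))) = t i] /\
  t i + t (s i) + t (s (s i)) = 0.
Proof.
split; last exact: t_sum.
split; [by rewrite Za1 p_eq0 add0r|by rewrite Za2 q_eq0|exact: Zt0|..].
  by rewrite Zt1 p_eq0 q_eq0 subr0.
by rewrite Zt2 q_eq0 subr0.
Qed.
End TriangleModule.

(** * Smooth functions *)

Section SmoothCalculus.
Variables (R : realType) (n : nat) (U : set 'rV[R]_n.+1).
Hypothesis oU : open U.
Implicit Types (f g : 'rV[R]_n.+1 -> R) (p : 'rV[R]_n.+1).

Lemma near_eq_open f g p : U p -> (forall q, U q -> f q = g q) ->
  {near p, f =1 g}.
Proof.
by move=> Up fg; have : nbhs p U by [exact: open_nbhs_nbhs]; apply: filterS.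
Qed.

Lemma eq_pderiv i f g : (forall p, U p -> f p = g p) ->
  forall p, U p -> pderiv i f p = pderiv i g p.
Proof. by move=> fg p Up; apply: near_eq_derive; exact: near_eq_open. Qed.

Lemma eq_class_C k f g : (forall p, U p -> f p = g p) ->
  class_C k U f -> class_C k U g.
Proof.
elim: k f g => [|k IH] f g fg /= [cf df]; split=> //.
- move=> p Up; suff : g @ p --> g p by []; rewrite -fg//.
  exact: cvg_trans (near_eq_cvg (near_eq_open Up fg)) (cf p Up).
- move=> p Up; suff : g @ p --> g p by []; rewrite -fg//.
  exact: cvg_trans (near_eq_cvg (near_eq_open Up fg)) (cf p Up).
- move=> i; have [df1 df2] := df i; split.
    by move=> p Up; apply: near_eq_derivable (df1 p Up); exact: near_eq_open.
  by apply: IH df2; exact: eq_pderiv.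
Qed.

Lemma class_CS k f : class_C k.+1 U f -> class_C k U f.
Proof.
elim: k f => [|k IH] f [cf df]; split=> // i.
by have [df1 df2] := df i; split=> //; apply: IH.
Qed.

Lemma class_C_cst k (c : R) : class_C k U (fun=> c).
Proof.
elim: k c => [|k IH] c; (split; first by move=> p _; exact: cst_continuous) => // i.
split; first by move=> p _; exact: derivable_cst.
by apply: eq_class_C (IH 0) => p _; rewrite /pderiv derive_cst.
Qed.

Lemma pderivD i f g p : derivable f p (delta_mx 0 i) ->
  derivable g p (delta_mx 0 i) ->
  pderiv i (fun q => f q + g q) p = pderiv i f p + pderiv i g p.
Proof. by move=> df dg; rewrite /pderiv -deriveD. Qed.

Lemma pderivN i f p : derivable f p (delta_mx 0 i) ->
  pderiv i (fun q => - f q) p = - pderiv i f p.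
Proof. by move=> df; rewrite /pderiv -deriveN. Qed.

Lemma pderivM i f g p : derivable f p (delta_mx 0 i) ->
  derivable g p (delta_mx 0 i) ->
  pderiv i (fun q => f q * g q) p = pderiv i f p * g p + f p * pderiv i g p.
Proof.
move=> df dg; rewrite /pderiv addrC [X in _ + X]mulrC.
by have := deriveM df dg.
Qed.

Lemma pderivV i f p : f p != 0 -> derivable f p (delta_mx 0 i) ->
  pderiv i (fun q => (f q)^-1) p = - ((f p)^-1 * (f p)^-1 * pderiv i f p).
Proof.
by move=> f0 df; rewrite /pderiv -invfM -expr2 -mulNr; have := deriveV f0 df.
Qed.

Lemma pderiv_coord i j p :
  derivable (fun q : 'rV[R]_n.+1 => q 0 j) p (delta_mx 0 i) /\
  pderiv i (fun q => q 0 j) p = (j == i)%:R.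
Proof.
split; first exact/diff_derivable/differentiable_coord.
rewrite /pderiv; apply: cvg_lim => //.
apply: cvg_near_cst; near=> h.
have h0 : h != 0 by near: h; exact: nbhs_dnbhs_neq.
by rewrite /= !mxE eqxx addrK /GRing.scale/= mulrA mulVf// mul1r.
Unshelve. all: by end_near. Qed.

Lemma class_C_coord k j : class_C k U (fun p => p 0 j).
Proof.
case: k => [|k]; (split; first by move=> p _; exact: coord_continuous) => // i.
split; first by move=> p _; have [] := pderiv_coord i j p.
apply: eq_class_C (class_C_cst k (j == i)%:R) => p _.
by have [_ ->] := pderiv_coord i j p.
Qed.

Lemma class_CD k f g :
  class_C k U f -> class_C k U g -> class_C k U (fun p => f p + g p).
Proof.
elim: k f g => [|k IH] f g /= [cf df] [cg dg].
  by split=> // p Up; apply: continuousD; [exact: cf|exact: cg].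
split=> [p Up|i]; first by apply: continuousD; [exact: cf|exact: cg].
have [df1 df2] := df i; have [dg1 dg2] := dg i; split.
  by move=> p Up; apply: derivableD; [exact: df1|exact: dg1].
apply: eq_class_C (IH _ _ df2 dg2) => p Up.
by rewrite pderivD//; [exact: df1|exact: dg1].
Qed.

Lemma class_CM k f g :
  class_C k U f -> class_C k U g -> class_C k U (fun p => f p * g p).
Proof.
elim: k f g => [|k IH] f g Cf Cg; have [cf df] := Cf; have [cg dg] := Cg.
  by split=> // p Up; apply: continuousM; [exact: cf|exact: cg].
split=> [p Up|i]; first by apply: continuousM; [exact: cf|exact: cg].
have [df1 df2] := df i; have [dg1 dg2] := dg i; split.
  by move=> p Up; apply: derivableM; [exact: df1|exact: dg1].
apply: (@eq_class_C _ (fun p => pderiv i f p * g p + f p * pderiv i g p)).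
  by move=> p Up; rewrite pderivM//; [exact: df1|exact: dg1].
by apply: class_CD; apply: IH => //; exact: class_CS.
Qed.

Lemma class_CN k f : class_C k U f -> class_C k U (fun p => - f p).
Proof.
move=> /(class_CM (class_C_cst k (-1))).
by apply: eq_class_C => p _; rewrite mulN1r.
Qed.

Lemma class_CV k f : (forall p, U p -> f p != 0) ->
  class_C k U f -> class_C k U (fun p => (f p)^-1).
Proof.
move=> f0; elim: k => [|k IH] Cf; have [cf df] := Cf.
  by split=> // p Up; apply: continuousV; [exact: f0|exact: cf].
split=> [p Up|i]; first by apply: continuousV; [exact: f0|exact: cf].
have [df1 df2] := df i; split.
  by move=> p Up; apply: derivableV; [exact: f0|exact: df1].
apply: (@eq_class_C _ (fun p => - ((f p)^-1 * (f p)^-1 * pderiv i f p))).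
  by move=> p Up; rewrite pderivV//; [exact: f0|exact: df1].
have Vf := IH (class_CS Cf).
by apply: class_CN; apply: class_CM => //; apply: class_CM.
Qed.

Lemma eq_smooth_on f g : (forall p, U p -> f p = g p) ->
  smooth_on U f -> smooth_on U g.
Proof. by move=> fg sf k; apply: eq_class_C (sf k). Qed.

Lemma smooth_cst (c : R) : smooth_on U (fun=> c).
Proof. by move=> k; exact: class_C_cst. Qed.

Lemma smooth_coord j : smooth_on U (fun p => p 0 j).
Proof. by move=> k; exact: class_C_coord. Qed.

Lemma smoothD f g : smooth_on U f -> smooth_on U g ->
  smooth_on U (fun p => f p + g p).
Proof. by move=> sf sg k; exact: class_CD. Qed.

Lemma smoothN f : smooth_on U f -> smooth_on U (fun p => - f p).
Proof. by move=> sf k; exact: class_CN. Qed.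

Lemma smoothB f g : smooth_on U f -> smooth_on U g ->
  smooth_on U (fun p => f p - g p).
Proof. by move=> sf sg; apply: smoothD => //; exact: smoothN. Qed.

Lemma smoothM f g : smooth_on U f -> smooth_on U g ->
  smooth_on U (fun p => f p * g p).
Proof. by move=> sf sg k; exact: class_CM. Qed.

Lemma smoothV f : (forall p, U p -> f p != 0) -> smooth_on U f ->
  smooth_on U (fun p => (f p)^-1).
Proof. by move=> f0 sf k; exact: class_CV. Qed.

Lemma smooth_sum (I : Type) (r : seq I) (P : pred I) (F : I -> 'rV[R]_n.+1 -> R) :
  (forall i, smooth_on U (F i)) ->
  smooth_on U (fun p => \sum_(i <- r | P i) F i p).
Proof.
move=> sF; elim: r => [|i r IH].
  by apply: eq_smooth_on (smooth_cst 0) => p _; rewrite big_nil.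
have [Pi|Pi] := boolP (P i).
  by apply: eq_smooth_on (smoothD (sF i) IH) => p _; rewrite big_cons Pi.
by apply: eq_smooth_on IH => p _; rewrite big_cons (negPf Pi).
Qed.

Lemma smooth_pderiv i f : smooth_on U f -> smooth_on U (pderiv i f).
Proof. by move=> sf k; have [_ /(_ i)[]] := sf k.+1. Qed.

Lemma smooth_derivable i f p : smooth_on U f -> U p ->
  derivable f p (delta_mx 0 i).
Proof. by move=> sf Up; have [_ /(_ i)[+ _]] := sf 1%N; exact. Qed.

Lemma smooth_continuous f p : smooth_on U f -> U p -> {for p, continuous f}.
Proof. by move=> sf Up; have [+ _] := sf 0%N; exact. Qed.

Lemma pderiv_sum i m (F : 'I_m -> 'rV[R]_n.+1 -> R) p :
  (forall k, smooth_on U (F k)) -> U p ->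
  pderiv i (fun q => \sum_k F k q) p = \sum_k pderiv i (F k) p.
Proof.
move=> sF Up; rewrite /pderiv -derive_sum; last first.
  by move=> k; exact: smooth_derivable.
by congr ('D_ _ _ p); apply/funext => q; rewrite fct_sumE.
Qed.

End SmoothCalculus.

Section SecondDerivatives.
Variables (R : realType) (n : nat) (U : set 'rV[R]_n.+1).
Hypothesis oU : open U.
Implicit Types (f g : 'rV[R]_n.+1 -> R) (p q : 'rV[R]_n.+1).
Local Notation e_ i := (delta_mx 0 i : 'rV[R]_n.+1).

Lemma is_derive_line f p i (t : R) : derivable f (p + t *: e_ i) (e_ i) ->
  is_derive t 1 (fun t : R => f (p + t *: e_ i)) (pderiv i f (p + t *: e_ i)).
Proof.
move=> df.
have E : (fun h : R => h^-1 *: (((fun u : R => f (p + u *: e_ i)) \o shift t) (h *: 1)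
            - f (p + t *: e_ i))) =
         (fun h : R => h^-1 *: ((f \o shift (p + t *: e_ i)) (h *: e_ i)
            - f (p + t *: e_ i))).
  apply/funext => h /=; congr (_ *: (f _ - _)).
  by rewrite [h *: 1]mulr1 scalerDl addrCA.
split; first by rewrite /derivable E.
by rewrite /derive E.
Qed.

Lemma pderiv_MVT f p i (h : R) : 0 < h ->
  (forall t, 0 <= t <= h -> derivable f (p + t *: e_ i) (e_ i)) ->
  exists2 t, 0 < t < h & f (p + h *: e_ i) - f p = pderiv i f (p + t *: e_ i) * h.
Proof.
move=> h0 df.
have [||c /[!in_itv]/= ch] := @MVT R (fun t => f (p + t *: e_ i))
    (fun t => pderiv i f (p + t *: e_ i)) 0 h h0.
- move=> t /[!in_itv]/= /andP[t0 th].
  by apply/is_derive_line/df; rewrite !ltW.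
- apply: derivable_within_continuous => t /[!in_itv]/= th.
  by have [] := is_derive_line (df _ th).
by rewrite scale0r addr0 subr0 => E; exists c.
Qed.

Lemma second_difference f p i j (h : R) : 0 < h -> smooth_on U f ->
  (forall u v, 0 <= u <= h -> 0 <= v <= h -> U (p + u *: e_ i + v *: e_ j)) ->
  exists u v, [/\ 0 <= u <= h, 0 <= v <= h &
    f (p + h *: e_ i + h *: e_ j) - f (p + h *: e_ i) - f (p + h *: e_ j) + f p =
    pderiv j (pderiv i f) (p + u *: e_ i + v *: e_ j) * h * h].
Proof.
move=> h0 sf Uuv.
have hh : 0 <= h <= h by rewrite ltW/=.
have d1 t : 0 <= t <= h -> derivable f (p + h *: e_ j + t *: e_ i) (e_ i).
  by move=> th; apply: smooth_derivable sf _; rewrite addrAC; exact: Uuv.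
have d0 t : 0 <= t <= h -> derivable f (p + t *: e_ i) (e_ i).
  move=> th; apply: smooth_derivable sf _.
  by have := Uuv t 0 th; rewrite scale0r addr0; apply; rewrite lexx ltW.
have [||u /[!in_itv]/= uh] := @MVT R
    (fun t => f (p + h *: e_ j + t *: e_ i) - f (p + t *: e_ i))
    (fun t => pderiv i f (p + h *: e_ j + t *: e_ i) - pderiv i f (p + t *: e_ i))
    0 h h0.
- move=> t /[!in_itv]/= /andP[t0 th]; apply: is_deriveB.
    by apply/is_derive_line/d1; rewrite !ltW.
  by apply/is_derive_line/d0; rewrite !ltW.
- apply: derivable_within_continuous => t /[!in_itv]/= th; apply: derivableB.
    by have [] := is_derive_line (d1 _ th).
  by have [] := is_derive_line (d0 _ th).
rewrite !scale0r !addr0 subr0 => E.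
have uh' : 0 <= u <= h by case/andP: uh => u0 uh; rewrite !ltW.
have [|v vh E2] := @pderiv_MVT (pderiv i f) (p + u *: e_ i) j h h0.
  move=> t th; apply: smooth_derivable (smooth_pderiv i sf) _; exact: Uuv.
exists u, v; split=> //; first by case/andP: vh => v0 vh; rewrite !ltW.
rewrite -E2 [p + u *: _ + _]addrAC -E [p + h *: _ + h *: _]addrAC.
by ring.
Qed.

Lemma ball_corner p i j (e u v : R) : 0 <= u <= e / 3 -> 0 <= v <= e / 3 -> 0 < e ->
  ball p e (p + u *: e_ i + v *: e_ j).
Proof.
move=> /andP[u0 ue] /andP[v0 ve] e0; split=> // a b; rewrite /ball /= !mxE.
have -> : p a b - (p a b + u * ((a == 0) && (b == i))%:R + v * ((a == 0) && (b == j))%:R)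
  = - (u * ((a == 0) && (b == i))%:R + v * ((a == 0) && (b == j))%:R) by ring.
rewrite normrN ger0_norm; last by rewrite addr_ge0// mulr_ge0.
by case: (_ && _); case: (_ && _); rewrite ?(mulr1, mulr0); lra.
Qed.

Lemma eq_of_close (A B : 'rV[R]_n.+1 -> R) p : A @ p --> A p -> B @ p --> B p ->
  (forall e : R, 0 < e -> exists q q', [/\ ball p e q, ball p e q' & A q = B q']) ->
  A p = B p.
Proof.
move=> cA cB H; apply/eqP/negPn/negP => AB.
pose d := `|A p - B p| / 2.
have d0 : 0 < d by rewrite divr_gt0// normr_gt0 subr_eq0.
have : \forall q \near p, `|A p - A q| < d /\ `|B p - B q| < d.
  move/cvgrPdist_lt : cA => /(_ _ d0) nA.
  move/cvgrPdist_lt : cB => /(_ _ d0) nB.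
  by apply: filterS2 nA nB => q; split.
move=> /nbhs_ballP[e /= e0 He].
have [q [q' [/He[Aq _] /He[_ Bq'] E]]] := H e e0.
have : `|A p - B p| < d + d.
  have -> : A p - B p = (A p - A q) - (B p - B q') by rewrite E; ring.
  by rewrite (le_lt_trans (ler_normB _ _))// ltrD.
by rewrite /d; lra.
Qed.

Lemma pderivC f i j p : smooth_on U f -> U p ->
  pderiv i (pderiv j f) p = pderiv j (pderiv i f) p.
Proof.
move=> sf Up; apply: eq_of_close.
- exact: smooth_continuous (smooth_pderiv i (smooth_pderiv j sf)) Up.
- exact: smooth_continuous (smooth_pderiv j (smooth_pderiv i sf)) Up.
move=> e1 e10.
have /nbhs_ballP[e2 /= e20 He2] : nbhs p U by exact: open_nbhs_nbhs.
pose e := Num.min e1 e2; have e0 : 0 < e by rewrite lt_min e10.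
have Be q : ball p e q -> ball p e1 q /\ U q.
  by move=> Bq; split; [|apply: He2]; apply: le_ball Bq; rewrite ge_min lexx ?orbT.
have h0 : 0 < e / 3 by rewrite divr_gt0.
have [|u [v [ue ve E1]]] := @second_difference f p i j (e / 3) h0 sf.
  by move=> u v ue ve; have [] := Be _ (ball_corner p i j ue ve e0).
have [|u' [v' [ue' ve' E2]]] := @second_difference f p j i (e / 3) h0 sf.
  by move=> u' v' ue' ve'; have [] := Be _ (ball_corner p j i ue' ve' e0).
exists (p + u' *: e_ j + v' *: e_ i), (p + u *: e_ i + v *: e_ j); split.
- by have [] := Be _ (ball_corner p j i ue' ve' e0).
- by have [] := Be _ (ball_corner p i j ue ve e0).
have h1 : e / 3 != 0 by rewrite gt_eqF.
apply: (mulIf h1); apply: (mulIf h1).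
refine (etrans (esym E2) (etrans _ E1)).
by rewrite [p + _ *: e_ j + _]addrAC; ring.
Qed.

Lemma pderiv0_line_ge0 f p i (h : R) : smooth_on U f ->
  (forall q, U q -> pderiv i f q = 0) -> 0 <= h ->
  (forall t, 0 <= t <= h -> U (p + t *: e_ i)) -> f (p + h *: e_ i) = f p.
Proof.
move=> sf f0; rewrite le_eqVlt => /predU1P[<- _|h0 Ut].
  by rewrite scale0r addr0.
have [|t /andP[t0 th]] := @pderiv_MVT f p i h h0.
  by move=> t th; apply: smooth_derivable sf _; exact: Ut.
rewrite f0 ?mul0r; first by move/subr0_eq.
by apply: Ut; rewrite !ltW.
Qed.

Lemma pderiv0_line f p i (h : R) : smooth_on U f ->
  (forall q, U q -> pderiv i f q = 0) ->
  (forall t, `|t| <= `|h| -> U (p + t *: e_ i)) -> f (p + h *: e_ i) = f p.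
Proof.
move=> sf f0 Ut; have [h0|h0] := leP 0 h.
  apply: pderiv0_line_ge0 => // t /andP[t0 th]; apply: Ut.
  by rewrite !ger0_norm.
rewrite -[in RHS](addrK (h *: e_ i) p) -scaleNr; symmetry.
apply: pderiv0_line_ge0 => //; first lra.
move=> t /andP[t0 th]; rewrite -addrA -scalerDl; apply: Ut.
by rewrite !ler0_norm; lra.
Qed.

Lemma pderiv0_ball f p (e : R) : smooth_on U f ->
  (forall i q, U q -> pderiv i f q = 0) -> ball p e `<=` U ->
  forall q, ball p e q -> f q = f p.
Proof.
move=> sf f0 BU q [e0 Bq].
pose w k : 'rV[R]_n.+1 := \row_j (if (j < k)%N then q 0 j else p 0 j).
have w0 : w 0%N = p by apply/rowP => j; rewrite mxE.
have wn : w n.+1 = q by apply/rowP => j; rewrite mxE ltn_ord.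
suff H k : (k <= n.+1)%N -> f (w k) = f p by rewrite -wn H.
elim: k => [_|k IH kn]; first by rewrite w0.
rewrite -IH ?(ltnW kn)//; pose i := Ordinal kn.
have -> : w k.+1 = w k + (q 0 i - p 0 i) *: e_ i.
  apply/rowP => j; rewrite !mxE eqxx /=.
  have [->|ji] := eqVneq j i; first by rewrite ltnSn ltnn mulr1 addrC subrK.
  by rewrite mulr0 addr0 ltnS leq_eqVlt (_ : _ == _ = false)//; apply/negbTE.
apply: pderiv0_line => // [u Uu|t th]; first exact: f0.
apply: BU; split=> // a j; rewrite ord1 /ball /= !mxE eqxx /=.
have [->|ji] := eqVneq j i.
  rewrite ltnn mulr1 opprD addNKr normrN (le_lt_trans th)// distrC.
  exact: Bq.
rewrite mulr0 addr0; case: ifP => _; first exact: Bq.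
by rewrite subrr normr0.
Qed.

Lemma pderiv0_const f : connected U -> smooth_on U f ->
  (forall i q, U q -> pderiv i f q = 0) ->
  forall p q, U p -> U q -> f p = f q.
Proof.
move=> cU sf f0 p q Up Uq.
have op (S : set R) : open (U `&` [set x | S (f x)]).
  rewrite openE => x [Ux /= fx].
  have /nbhs_ballP[e /= e0 BU] : nbhs x U by exact: open_nbhs_nbhs.
  apply/nbhs_ballP; exists e => // y By; split; first exact: BU.
  by rewrite /= (pderiv0_ball sf f0 BU By).
suff : U `&` [set x | [set f p] (f x)] = U.
  by move/seteqP => [_ /(_ q Uq)[_ /=]].
apply: cU; first by exists p; split.
  by exists (U `&` [set x | [set f p] (f x)]) => //; rewrite setIA setIid.
exists (~` (U `&` [set x | (~` [set f p]) (f x)])).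
  by apply: open_closedC; exact: op.
apply/seteqP; split=> x /= [Ux fx]; split=> //.
  by move=> [].
by apply: contrapT => nfx; apply: fx.
Qed.
End SecondDerivatives.

(** * Linear vector fields *)

Section LinearFields.
Variables (R : realType) (n : nat) (U : set 'rV[R]_n.+1).
Hypothesis oU : open U.
Implicit Types (f g : 'rV[R]_n.+1 -> R) (p q : 'rV[R]_n.+1) (M N : 'M[R]_n.+1).

Definition lder M f p : R := \sum_j (p *m M) 0 j * pderiv j f p.

Lemma eq_lder M f g : (forall p, U p -> f p = g p) ->
  forall p, U p -> lder M f p = lder M g p.
Proof.
by move=> fg p Up; apply: eq_bigr => j _; rewrite (eq_pderiv oU j fg Up).
Qed.

Lemma smooth_mulmx M j : smooth_on U (fun p => (p *m M) 0 j).
Proof.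
have H : smooth_on U (fun p => \sum_k p 0 k * M k j).
  apply: smooth_sum => // k; apply: smoothM => //; first exact: smooth_coord.
  exact: smooth_cst.
by apply: eq_smooth_on H => // p _; rewrite mxE.
Qed.

Lemma pderiv_mulmx M i j p : U p -> pderiv i (fun q => (q *m M) 0 j) p = M i j.
Proof.
move=> Up.
rewrite (@eq_pderiv R n U oU i _ (fun q => \sum_k q 0 k * M k j))//; last first.
  by move=> q _; rewrite mxE.
rewrite (@pderiv_sum R n U)//; last first.
  move=> k; apply: smoothM => //; first exact: smooth_coord.
  exact: smooth_cst.
rewrite (bigD1 i)//= big1 ?addr0 => [|k ki].
  rewrite pderivM; [|exact: (pderiv_coord i i p).1|exact: derivable_cst].
  by rewrite (pderiv_coord i i p).2 eqxx /pderiv derive_cst mul1r mulr0 addr0.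
rewrite pderivM; [|exact: (pderiv_coord i k p).1|exact: derivable_cst].
by rewrite (pderiv_coord i k p).2 (negPf ki) /pderiv derive_cst mul0r mulr0 addr0.
Qed.

Lemma smooth_lder M f : smooth_on U f -> smooth_on U (lder M f).
Proof.
move=> sf; apply: smooth_sum => // j; apply: smoothM => //.
  exact: smooth_mulmx.
exact: smooth_pderiv.
Qed.

Lemma lderD M f g p : smooth_on U f -> smooth_on U g -> U p ->
  lder M (fun q => f q + g q) p = lder M f p + lder M g p.
Proof.
move=> sf sg Up; rewrite -big_split; apply: eq_bigr => j _ /=.
by rewrite pderivD ?mulrDr//; exact: smooth_derivable Up.
Qed.

Lemma lderM M f g p : smooth_on U f -> smooth_on U g -> U p ->
  lder M (fun q => f q * g q) p = lder M f p * g p + f p * lder M g p.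
Proof.
move=> sf sg Up; rewrite mulr_suml mulr_sumr -big_split; apply: eq_bigr => j _ /=.
rewrite pderivM; [by ring|exact: smooth_derivable Up..].
Qed.

Lemma lder_cst M (c : R) p : lder M (fun=> c) p = 0.
Proof. by apply: big1 => j _; rewrite /pderiv derive_cst mulr0. Qed.

Lemma lderN M f p : smooth_on U f -> U p ->
  lder M (fun q => - f q) p = - lder M f p.
Proof.
move=> sf Up; rewrite -sumrN; apply: eq_bigr => j _ /=.
by rewrite pderivN ?mulrN//; exact: smooth_derivable Up.
Qed.

Lemma lderB M f g p : smooth_on U f -> smooth_on U g -> U p ->
  lder M (fun q => f q - g q) p = lder M f p - lder M g p.
Proof. by move=> sf sg Up; rewrite lderD ?lderN//; exact: smoothN. Qed.

Lemma lder_sum M m (F : 'I_m -> 'rV[R]_n.+1 -> R) p :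
  (forall k, smooth_on U (F k)) -> U p ->
  lder M (fun q => \sum_k F k q) p = \sum_k lder M (F k) p.
Proof.
move=> sF Up; rewrite exchange_big; apply: eq_bigr => j _ /=.
by rewrite (pderiv_sum j sF Up) mulr_sumr.
Qed.

Lemma lder_mulmx M N j p : U p -> lder M (fun q => (q *m N) 0 j) p = (p *m M *m N) 0 j.
Proof.
by move=> Up; rewrite mxE; apply: eq_bigr => i _; rewrite pderiv_mulmx.
Qed.

Lemma lder_linear M N a f p : lder (a *: M + N) f p = a * lder M f p + lder N f p.
Proof.
rewrite mulr_sumr -big_split; apply: eq_bigr => j _ /=.
by rewrite mulmxDr -scalemxAr !mxE; ring.
Qed.

Lemma lder_comm M N f p : smooth_on U f -> U p ->
  lder M (lder N f) p - lder N (lder M f) p = lder (M *m N - N *m M) f p.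
Proof.
move=> sf Up.
have E M' N' : lder M' (lder N' f) p = lder (M' *m N') f p +
    \sum_i \sum_j (p *m M') 0 i * (p *m N') 0 j * pderiv i (pderiv j f) p.
  rewrite lder_sum//; last first.
    by move=> k; apply: smoothM => //; [exact: smooth_mulmx|exact: smooth_pderiv].
  under eq_bigr => j _.
    rewrite lderM//; [|exact: smooth_mulmx|exact: smooth_pderiv].
    rewrite lder_mulmx// /lder mulr_sumr; over.
  rewrite big_split/=; congr (_ + _); first by apply: eq_bigr => j _; rewrite mulmxA.
  rewrite exchange_big; apply: eq_bigr => i _; apply: eq_bigr => j _ /=; ring.
rewrite !E [\sum_i \sum_j _ in X in _ - X]exchange_big /=.
under [\sum_i \sum_j _ in X in _ - X]eq_bigr => i _.
  under eq_bigr => j _ do rewrite (pderivC oU _ _ sf Up) mulrC mulrA [_ * _ 0 j]mulrC.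
  over.
rewrite [lder (M *m N - N *m M) f p](_ : _ = lder (M *m N) f p - lder (N *m M) f p).
  rewrite opprD addrACA -[RHS]addr0; congr (_ + _).
  apply/eqP; rewrite subr_eq0; apply/eqP.
  by apply: eq_bigr => i _; apply: eq_bigr => j _; ring.
by rewrite addrC -scaleN1r lder_linear; ring.
Qed.
End LinearFields.

Section SmoothFunctions.
Variables (R : realType) (n : nat) (U : set 'rV[R]_n.+1) (oU : open U).

(* Smooth functions on [U] are extended by [0], so that equality on [U] is equality;
   openness of [U], a phantom argument here, makes them an additive group. *)
Definition smooth0 of open U : {pred ('rV[R]_n.+1 -> R)} :=
  fun f => `[< smooth_on U f /\ forall p, ~ U p -> f p = 0 >].

Lemma smooth0P f : reflect (smooth_on U f /\ forall p, ~ U p -> f p = 0)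
  (f \in smooth0 oU).
Proof. exact: asboolP. Qed.

Lemma smooth0_zmod_closed : zmod_closed (smooth0 oU).
Proof.
split=> [|f g /smooth0P[sf f0] /smooth0P[sg g0]]; apply/smooth0P; split => //.
- exact: smooth_cst.
- exact: smoothB.
- by move=> p Up; rewrite !fctE f0// g0// subr0.
Qed.

HB.instance Definition _ := GRing.isZmodClosed.Build _ (smooth0 oU)
  smooth0_zmod_closed.

Record smooth_fun :=
  SmoothFun { smooth_fun_val :> 'rV[R]_n.+1 -> R ; _ : smooth_fun_val \in smooth0 oU }.
Local Notation V := smooth_fun.
HB.instance Definition _ := [isSub for smooth_fun_val].
HB.instance Definition _ := [Choice of V by <:].
HB.instance Definition _ := [SubChoice_isSubZmodule of V by <:].

Lemma smooth_funP (f : V) : smooth_on U f.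
Proof. by case: f => f /= /smooth0P[]. Qed.

Lemma smooth_fun_out (f : V) p : ~ U p -> f p = 0.
Proof. by case: f => f /= /smooth0P[_]; exact. Qed.

Lemma smooth0_patch f : smooth_on U f -> patch (fun=> 0) U f \in smooth0 oU.
Proof.
move=> sf; apply/smooth0P; split=> [|p Up]; last first.
  by rewrite /patch memNset.
by apply: eq_smooth_on sf => // p Up; rewrite /patch mem_set.
Qed.

Definition smooth_restrict f (sf : smooth_on U f) : V := SmoothFun (smooth0_patch sf).

Lemma smooth_restrictE f (sf : smooth_on U f) p : U p -> smooth_restrict sf p = f p.
Proof. by move=> Up; rewrite /= /patch mem_set. Qed.

Definition smooth_fun_ev (p : 'rV[R]_n.+1) (f : V) : R := f p.

Lemma smooth_fun_ev_additive p : zmod_morphism (smooth_fun_ev p).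
Proof. by []. Qed.
HB.instance Definition _ p := GRing.isZmodMorphism.Build V R (smooth_fun_ev p)
  (smooth_fun_ev_additive p).

Lemma smooth_fun_eq (f g : V) : (forall p, U p -> f p = g p) -> f = g.
Proof.
move=> fg; apply/val_inj/funext => p /=.
by have [/fg//|Up] := pselect (U p); rewrite !smooth_fun_out.
Qed.

Lemma smooth_funB (f g : V) p : (f - g) p = f p - g p.
Proof. by []. Qed.

Definition ldv (M : 'M[R]_n.+1) (f : V) : V :=
  smooth_restrict (smooth_lder oU M (smooth_funP f)).

Lemma ldvE M f p : U p -> ldv M f p = lder M f p.
Proof. exact: smooth_restrictE. Qed.

Lemma ldv_additive M : zmod_morphism (ldv M).
Proof.
move=> f g; apply: smooth_fun_eq => p Up.
by rewrite smooth_funB !ldvE// -(lderB oU M (smooth_funP f) (smooth_funP g) Up).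
Qed.
HB.instance Definition _ M := GRing.isZmodMorphism.Build V V (ldv M)
  (ldv_additive M).

Lemma ldv_comm M N f : ldv M (ldv N f) - ldv N (ldv M f) = ldv (M *m N - N *m M) f.
Proof.
apply: smooth_fun_eq => p Up; rewrite smooth_funB !ldvE//.
rewrite (eq_lder oU M (g := lder N f))//; last exact: ldvE.
rewrite (eq_lder oU N (g := lder M f))//; last exact: ldvE.
by rewrite (lder_comm oU)//; exact: smooth_funP.
Qed.

Lemma smooth_funD (f g : V) p : (f + g) p = f p + g p.
Proof. by []. Qed.

Lemma smooth_funN (f : V) p : (- f) p = - f p.
Proof. by []. Qed.

Lemma ldv_addl M N f : ldv (M + N) f = ldv M f + ldv N f.
Proof.
apply: smooth_fun_eq => p Up; rewrite smooth_funD !ldvE//.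
by rewrite -[M]scale1r lder_linear mul1r scale1r.
Qed.

Lemma ldv_oppl M f : ldv (- M) f = - ldv M f.
Proof.
apply: smooth_fun_eq => p Up; rewrite smooth_funN !ldvE//.
have lder0 : lder 0 f p = 0 by apply: big1 => j _; rewrite mulmx0 mxE mul0r.
by rewrite -[- M]addr0 -scaleN1r lder_linear mulN1r lder0 addr0.
Qed.

End SmoothFunctions.

(** * The frame of a triangle *)

Lemma ordS3 (i : 'I_3) : ordS (ordS (ordS i)) = i.
Proof. by apply: val_inj; case: i => [[|[|[|]]]]. Qed.

Lemma ordS3_eqE (i : 'I_3) :
  ((i == ordS i) = false) * ((ordS i == i) = false) *
  ((i == ordS (ordS i)) = false) * ((ordS (ordS i) == i) = false) *
  ((ordS i == ordS (ordS i)) = false) * ((ordS (ordS i) == ordS i) = false).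
Proof. by case: i => [[|[|[|]]]]. Qed.

Lemma ordS3_ind (i : 'I_3) (P : 'I_3 -> Prop) :
  P i -> P (ordS i) -> P (ordS (ordS i)) -> forall j, P j.
Proof.
move=> P0 P1 P2 j.
suff : [|| j == i, j == ordS i | j == ordS (ordS i)] by case/or3P => /eqP->.
by case: i j {P0 P1 P2} => [[|[|[|]]]]// ? [[|[|[|]]]].
Qed.

Lemma big_ordS3 (V : nmodType) (i : 'I_3) (F : 'I_3 -> V) :
  \sum_j F j = F i + F (ordS i) + F (ordS (ordS i)).
Proof.
rewrite (bigD1 i)//= (bigD1 (ordS i))/=; last by rewrite ordS3_eqE.
rewrite (bigD1 (ordS (ordS i)))/=; last by rewrite !ordS3_eqE.
rewrite big1 ?addr0 ?addrA// => j /andP[/andP[/negPf j0 /negPf j1] /negPf j2].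
by exfalso; move: j0 j1 j2; elim/(@ordS3_ind i) : j; rewrite eqxx.
Qed.

Lemma xidx_eq i j : (xidx i == xidx j) = (i == j).
Proof.
by case: i j => [[|[|[|]]]]// ? [[|[|[|]]]]// ?; rewrite -val_eqE /xidx /yidx/= !inordK.
Qed.
Lemma yidx_eq i j : (yidx i == yidx j) = (i == j).
Proof.
by case: i j => [[|[|[|]]]]// ? [[|[|[|]]]]// ?; rewrite -val_eqE /xidx /yidx/= !inordK.
Qed.
Lemma xyidx_eq i j : (xidx i == yidx j) = false.
Proof.
by case: i j => [[|[|[|]]]]// ? [[|[|[|]]]]// ?; rewrite -val_eqE /xidx /yidx/= !inordK.
Qed.
Lemma yxidx_eq i j : (yidx i == xidx j) = false.
Proof. by rewrite eq_sym xyidx_eq. Qed.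
Definition idxE := (xidx_eq, yidx_eq, xyidx_eq, yxidx_eq).

Lemma idx_ind (P : 'I_6 -> Prop) :
  (forall i, P (xidx i)) -> (forall i, P (yidx i)) -> forall j, P j.
Proof.
move=> Px Py j; suff : exists i, j = xidx i \/ j = yidx i.
  by case=> i [->|->].
have H k : (k < 3)%N -> (inord k : 'I_3) = k :> nat by move=> k3; rewrite inordK.
exists (inord (j./2)).
case: j => [[|[|[|[|[|[|]]]]]]]//= j6.
- by left; apply: val_inj; rewrite /xidx/= H// inordK.
- by right; apply: val_inj; rewrite /yidx/= H// inordK.
- by left; apply: val_inj; rewrite /xidx/= H// inordK.
- by right; apply: val_inj; rewrite /yidx/= H// inordK.
- by left; apply: val_inj; rewrite /xidx/= H// inordK.
- by right; apply: val_inj; rewrite /yidx/= H// inordK.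
Qed.

Section TriangleFields.
Variable R : realType.
Implicit Types (p : 'rV[R]_6) (C D : 'M[R]_3).

Definition xmx : 'M[R]_(3, 6) := \matrix_(i, j) (j == xidx i)%:R.
Definition ymx : 'M[R]_(3, 6) := \matrix_(i, j) (j == yidx i)%:R.

Lemma xmxE i j : xmx i j = (j == xidx i)%:R. Proof. by rewrite mxE. Qed.
Lemma ymxE i j : ymx i j = (j == yidx i)%:R. Proof. by rewrite mxE. Qed.

Lemma xmxT m (A : 'M[R]_(m, 6)) i j : (A *m xmx^T) i j = A i (xidx j).
Proof.
rewrite mxE (bigD1 (xidx j))//= !mxE eqxx mulr1 big1 ?addr0// => k /negPf kj.
by rewrite !mxE kj mulr0.
Qed.
Lemma ymxT m (A : 'M[R]_(m, 6)) i j : (A *m ymx^T) i j = A i (yidx j).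
Proof.
rewrite mxE (bigD1 (yidx j))//= !mxE eqxx mulr1 big1 ?addr0// => k /negPf kj.
by rewrite !mxE kj mulr0.
Qed.

Definition tens C : 'M[R]_6 := xmx^T *m C *m xmx + ymx^T *m C *m ymx.

Lemma tensM C D : tens C *m tens D = tens (C *m D).
Proof.
have xx : xmx *m xmx^T = 1%:M.
  by apply/matrixP => i j; rewrite xmxT !mxE idxE eq_sym.
have yy : ymx *m ymx^T = 1%:M.
  by apply/matrixP => i j; rewrite ymxT !mxE idxE eq_sym.
have xy : xmx *m ymx^T = 0.
  by apply/matrixP => i j; rewrite ymxT !mxE idxE.
have yx : ymx *m xmx^T = 0.
  by apply/matrixP => i j; rewrite xmxT !mxE idxE.
have E (A : 'M[R]_(6, 3)) (A' : 'M[R]_(3, 6)) (B B' : 'M[R]_(3, 6)) :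
    A *m C *m B *m (B'^T *m D *m A') = A *m C *m (B *m B'^T) *m D *m A'.
  by rewrite !mulmxA.
by rewrite mulmxDl !mulmxDr !E xx yy xy yx !mulmx0 !mul0mx addr0 add0r !mulmx1 /tens !mulmxA.
Qed.

Lemma tensB C D : tens (C - D) = tens C - tens D.
Proof. by rewrite /tens !(mulmxBr, mulmxBl) opprD addrACA. Qed.

Lemma tensN C : tens (- C) = - tens C.
Proof. by rewrite -[LHS](congr1 tens (sub0r C)) tensB /tens !mulmx0 !mul0mx addr0 sub0r. Qed.

Lemma tensD C D : tens (C + D) = tens C + tens D.
Proof. by rewrite -[D in LHS]opprK tensB tensN opprK. Qed.

Lemma mul_tens_x p C k : (p *m tens C) 0 (xidx k) = \sum_l xc l p * C l k.
Proof.
rewrite mulmxDr !mulmxA mxE.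
have -> : (p *m xmx^T *m C *m xmx) 0 (xidx k) = (p *m xmx^T *m C) 0 k.
  rewrite mxE (bigD1 k)//= xmxE idxE eqxx mulr1 big1 ?addr0// => l lk.
  by rewrite xmxE idxE eq_sym (negPf lk) mulr0.
rewrite [X in _ + X](_ : _ = 0) ?addr0.
  by rewrite mxE; apply: eq_bigr => l _; rewrite xmxT.
by rewrite mxE big1// => l _; rewrite !mxE idxE mulr0.
Qed.

Lemma mul_tens_y p C k : (p *m tens C) 0 (yidx k) = \sum_l yc l p * C l k.
Proof.
rewrite mulmxDr !mulmxA mxE.
have -> : (p *m ymx^T *m C *m ymx) 0 (yidx k) = (p *m ymx^T *m C) 0 k.
  rewrite mxE (bigD1 k)//= ymxE idxE eqxx mulr1 big1 ?addr0// => l lk.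
  by rewrite ymxE idxE eq_sym (negPf lk) mulr0.
rewrite [X in X + _](_ : _ = 0) ?add0r.
  by rewrite mxE; apply: eq_bigr => l _; rewrite ymxT.
by rewrite mxE big1// => l _; rewrite !mxE idxE mulr0.
Qed.

Lemma big_idx (F : 'I_6 -> R) : \sum_j F j = \sum_i (F (xidx i) + F (yidx i)).
Proof.
rewrite !big_ord_recl !big_ord0.
have -> : F ord0 = F (xidx 0) by congr F; apply: val_inj; rewrite /= inordK.
have -> : F (lift ord0 ord0) = F (yidx 0) by congr F; apply: val_inj; rewrite /= inordK.
have E k (j : 'I_6) : k = j :> nat -> j = inord k by move=> ->; rewrite inord_val.
rewrite [lift ord0 (lift ord0 ord0)](E 2%N)//.
rewrite [lift ord0 (lift ord0 (lift ord0 ord0))](E 3%N)//.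
rewrite [lift ord0 (lift ord0 (lift ord0 (lift ord0 ord0)))](E 4%N)//.
rewrite [lift ord0 (lift ord0 (lift ord0 (lift ord0 (lift ord0 ord0))))](E 5%N)//.
by rewrite /xidx /yidx /=; ring.
Qed.

Definition dZ (i : 'I_3) : 'M[R]_3 := delta_mx (ordS i) i - delta_mx i i.
Definition dW (i : 'I_3) : 'M[R]_3 :=
  delta_mx (ordS (ordS i)) i - delta_mx (ordS i) i.

Ltac deltas i := rewrite /dZ /dW ?ordS3 !(mulmxBl, mulmxBr) !mul_delta_mx_cond
  !ordS3_eqE ?eqxx ?mulr0n ?mulr1n; apply/matrixP => u v; rewrite !mxE; ring.

Lemma comm_ZZ i : dZ i *m dZ (ordS i) - dZ (ordS i) *m dZ i = - dW i.
Proof. by deltas i. Qed.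
Lemma comm_ZW0 i : dZ i *m dW i - dW i *m dZ i = dW i.
Proof. by deltas i. Qed.
Lemma comm_ZW1 i : dZ (ordS i) *m dW i - dW i *m dZ (ordS i) = - dW i.
Proof. by deltas i. Qed.
Lemma comm_ZW2 i :
  dZ (ordS (ordS i)) *m dW i - dW i *m dZ (ordS (ordS i)) =
  - dZ i - dW i + dW (ordS (ordS i)) + dZ (ordS (ordS i)).
Proof. by deltas i. Qed.

End TriangleFields.

Section VectorFields.
Variables (R : realType) (n : nat) (U : set 'rV[R]_n.+1).
Hypothesis oU : open U.
Implicit Type p : 'rV[R]_n.+1.

Lemma vf_restrictE (X : 'rV[R]_n.+1 -> 'rV[R]_n.+1) p : U p -> vf_restrict U X p = X p.
Proof. by move=> Up; rewrite /vf_restrict /patch mem_set. Qed.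

Lemma vf_restrict_out (X : 'rV[R]_n.+1 -> 'rV[R]_n.+1) p : ~ U p -> vf_restrict U X p = 0.
Proof. by move=> Up; rewrite /vf_restrict /patch memNset. Qed.

Lemma vector_field_restrict (X : 'rV[R]_n.+1 -> 'rV[R]_n.+1) :
  (forall j, smooth_on U (fun p => X p 0 j)) -> vector_field U (vf_restrict U X).
Proof.
move=> sX; split=> [j|p Up]; last first.
  by rewrite vf_restrict_out//; apply/funext => i; apply/funext => j; rewrite mxE.
by apply: eq_smooth_on (sX j) => // p Up; rewrite vf_restrictE.
Qed.

Lemma vector_field_out (X : 'rV[R]_n.+1 -> 'rV[R]_n.+1) p :
  vector_field U X -> ~ U p -> X p = 0.
Proof. by move=> [_ X0] Up; apply/matrixP => i j; rewrite X0// mxE. Qed.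

End VectorFields.

Section Symmetries.
Variables (R : realType).
Implicit Types (p v : 'rV[R]_6).

Definition ex (j : 'I_3) p : R := xc (ordS j) p - xc j p.
Definition ey (j : 'I_3) p : R := yc (ordS j) p - yc j p.
Definition area p : R := ex ord0 p * ey (ordS ord0) p - ex (ordS ord0) p * ey ord0 p.

Lemma areaE i p : ex i p * ey (ordS i) p - ex (ordS i) p * ey i p = area p.
Proof.
by elim/(@ordS3_ind ord0): i => //; rewrite /area /ex /ey !ordS3; ring.
Qed.

Lemma area_neq0 p : ~ collinear p -> area p != 0.
Proof.
apply: contra_notN => /eqP A0.
have [e0|/existsNP[j ej]] := pselect (forall j, ex j p = 0 /\ ey j p = 0).
  exists 1, 0, (xc ord0 p); split; first by case=> /eqP; rewrite oner_eq0.
  move=> i; have [e1 _] := e0 ord0; have [e2 _] := e0 (ordS ord0).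
  by elim/(@ordS3_ind ord0): i; move: e1 e2; rewrite /ex; lra.
exists (ey j p), (- ex j p), (ey j p * xc j p - ex j p * yc j p); split.
  case=> yj0 /eqP; rewrite oppr_eq0 => /eqP xj0; exact: ej.
move=> i; have := areaE j p; rewrite A0 /ex /ey => E.
by elim/(@ordS3_ind j): i; lra.
Qed.

Lemma antD_coord p k l : antD p k l = ex k p * (l == xidx k)%:R + ey k p * (l == yidx k)%:R.
Proof. by rewrite !mxE eqxx. Qed.

Lemma antD_cross p v : (v <= antD p)%MS ->
  forall j, ex j p * v 0 (yidx j) = ey j p * v 0 (xidx j).
Proof.
move=> /submxP[D ->] j.
have E l : (forall k, k != j -> antD p k l = 0) -> (D *m antD p) 0 l = D 0 j * antD p j l.
  by move=> H; rewrite mxE (bigD1 j)//= big1 ?addr0// => k /H->; rewrite mulr0.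
rewrite !E; first by rewrite !antD_coord !idxE eqxx /=; ring.
all: by move=> k /negPf kj; rewrite antD_coord !idxE [j == k]eq_sym kj !mulr0 addr0.
Qed.

Lemma cross_antD p v : area p != 0 ->
  (forall j, ex j p * v 0 (yidx j) = ey j p * v 0 (xidx j)) -> (v <= antD p)%MS.
Proof.
move=> A0 H; apply/submxP.
pose c j := (v 0 (xidx j) * ey (ordS j) p - v 0 (yidx j) * ex (ordS j) p) / area p.
exists (\row_j c j); apply/rowP; elim/idx_ind => j; rewrite mxE (bigD1 j)//= big1 ?addr0;
  try by move=> k kj; rewrite antD_coord !idxE [j == k]eq_sym (negPf kj) ?mulr0 ?addr0 ?mulr0.
- rewrite antD_coord !idxE eqxx !mxE /c.
  rewrite mulr1 mulr0 addr0; apply: (mulIf A0); rewrite mulrAC divfK// -(areaE j p).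
  have := congr1 ( *%R (ex (ordS j) p)) (H j); lra.
- rewrite antD_coord !idxE eqxx !mxE /c.
  rewrite mulr1 mulr0 add0r; apply: (mulIf A0); rewrite mulrAC divfK// -(areaE j p).
  have := congr1 ( *%R (ey (ordS j) p)) (H j); lra.
Qed.

Lemma sum_dZ (v : 'I_3 -> R) i k :
  \sum_l v l * dZ R i l k = (v (ordS i) - v i) * (k == i)%:R.
Proof.
rewrite (big_ordS3 i) !mxE !ordS3_eqE !eqxx.
by elim/(@ordS3_ind i): k; rewrite ?ordS3_eqE ?eqxx /=; ring.
Qed.

Lemma antZ_mul i p : antZ i p = p *m tens (dZ R i).
Proof.
apply/rowP; elim/idx_ind => k; rewrite ?(mul_tens_x, mul_tens_y) sum_dZ !mxE eqxx
  !idxE /=; ring.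
Qed.

Variable U : set 'rV[R]_6.
Hypothesis oU : open U.
Hypothesis ncU : forall p, U p -> ~ collinear p.

Local Notation Zd i := (lder (tens (dZ R i))).

Lemma lder_coord (M : 'M[R]_6) k p : U p -> lder M (fun q => q 0 k) p = (p *m M) 0 k.
Proof.
move=> Up; rewrite -[RHS](congr1 (fun A : 'rV__ => A 0 k) (mulmx1 _)).
rewrite -(lder_mulmx oU)//; apply: (eq_lder oU) => // q _.
by rewrite mulmx1.
Qed.

Lemma smooth_xc k : smooth_on U (@xc R k). Proof. exact: smooth_coord. Qed.
Lemma smooth_yc k : smooth_on U (@yc R k). Proof. exact: smooth_coord. Qed.
Lemma smooth_ex k : smooth_on U (ex k).
Proof. by apply: smoothB => //; exact: smooth_xc. Qed.
Lemma smooth_ey k : smooth_on U (ey k).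
Proof. by apply: smoothB => //; exact: smooth_yc. Qed.
Lemma smooth_area : smooth_on U area.
Proof.
by apply: smoothB => //; apply: smoothM => //; (exact: smooth_ex || exact: smooth_ey).
Qed.

Lemma Zd_ex i j p : U p -> Zd i (ex j) p = ex i p * ((ordS j == i)%:R - (j == i)%:R).
Proof.
move=> Up; rewrite (lderB oU _ (smooth_xc _) (smooth_xc _) Up) !lder_coord//.
by rewrite !mul_tens_x !sum_dZ /ex; ring.
Qed.
Lemma Zd_ey i j p : U p -> Zd i (ey j) p = ey i p * ((ordS j == i)%:R - (j == i)%:R).
Proof.
move=> Up; rewrite (lderB oU _ (smooth_yc _) (smooth_yc _) Up) !lder_coord//.
by rewrite !mul_tens_y !sum_dZ /ey; ring.
Qed.

Lemma antZ_section i : dist_section U (@antD R) (vf_restrict U (antZ i)).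
Proof.
split=> [|p Up].
  apply: (vector_field_restrict oU) => j.
  by apply: (eq_smooth_on oU) (smooth_mulmx oU (tens (dZ R i)) j) => p _; rewrite antZ_mul.
by rewrite vf_restrictE//; have := row_sub i (antD p); rewrite rowK.
Qed.

Lemma bracket_antZ (X : 'rV[R]_6 -> 'rV[R]_6) i p l : U p ->
  vf_bracket U X (vf_restrict U (antZ i)) p 0 l =
  (X p *m tens (dZ R i)) 0 l - Zd i (fun q => X q 0 l) p.
Proof.
move=> Up; rewrite /vf_bracket vf_restrictE// !mxE /lder -sumrB.
apply: eq_bigr => k _; congr (_ * _ - _ * _); last by rewrite vf_restrictE// antZ_mul.
rewrite -(pderiv_mulmx oU (tens (dZ R i)) k l Up).
by apply: (eq_pderiv oU) => // q Uq; rewrite vf_restrictE// antZ_mul.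
Qed.

End Symmetries.

(** * From symmetries to projective vector fields *)

Section SymmetryIsProjective.
Variables (R : realType) (U : set 'rV[R]_6).
Hypothesis oU : open U.
Hypothesis ncU : forall p, U p -> ~ collinear p.
Variable X : 'rV[R]_6 -> 'rV[R]_6.
Hypothesis hX : symmetries U (@antD R) X.
Local Notation Zd i := (lder (tens (dZ R i))).
Local Notation s := (@ordS 3).
Implicit Types (p : 'rV[R]_6) (i j : 'I_3).

Let sX (j : 'I_6) : smooth_on U (fun p => X p 0 j).
Proof. by have [[+ _] _] := hX; exact. Qed.

Let A0 p : U p -> area p != 0.
Proof. by move=> /ncU; exact: area_neq0. Qed.

Lemma smooth_alpha i : smooth_on U (fun p =>
  (X p 0 (xidx i) * ey (s i) p - X p 0 (yidx i) * ex (s i) p) / area p).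
Proof.
apply: (smoothM oU); last exact: (smoothV oU A0 (smooth_area oU)).
by apply: (smoothB oU); apply: (smoothM oU) => //;
  [exact: (smooth_ey oU)|exact: (smooth_ex oU)].
Qed.

Lemma smooth_beta i : smooth_on U (fun p =>
  (ex i p * X p 0 (yidx i) - ey i p * X p 0 (xidx i)) / area p).
Proof.
apply: (smoothM oU); last exact: (smoothV oU A0 (smooth_area oU)).
by apply: (smoothB oU); apply: (smoothM oU) => //;
  [exact: (smooth_ex oU)|exact: (smooth_ey oU)].
Qed.

Local Notation V := (smooth_fun oU).
Definition alpha i : V := smooth_restrict oU (smooth_alpha i).
Definition beta i : V := smooth_restrict oU (smooth_beta i).

Lemma X_xE i p : U p -> X p 0 (xidx i) = alpha i p * ex i p + beta i p * ex (s i) p.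
Proof.
move=> Up; rewrite !smooth_restrictE//; have := A0 Up; rewrite -(areaE i p) => AA.
by field.
Qed.

Lemma X_yE i p : U p -> X p 0 (yidx i) = alpha i p * ey i p + beta i p * ey (s i) p.
Proof.
move=> Up; rewrite !smooth_restrictE//; have := A0 Up; rewrite -(areaE i p) => AA.
by field.
Qed.

Lemma ex_sum i p : ex (s (s i)) p = - ex i p - ex (s i) p.
Proof. by rewrite /ex ordS3; ring. Qed.
Lemma ey_sum i p : ey (s (s i)) p = - ey i p - ey (s i) p.
Proof. by rewrite /ey ordS3; ring. Qed.

Let sa i : smooth_on U (alpha i). Proof. exact: smooth_funP. Qed.
Let sb i : smooth_on U (beta i). Proof. exact: smooth_funP. Qed.

Lemma Zd_Xx i j p : U p -> Zd i (fun q => X q 0 (xidx j)) p =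
  Zd i (alpha j) p * ex j p + alpha j p * (ex i p * ((s j == i)%:R - (j == i)%:R)) +
  (Zd i (beta j) p * ex (s j) p +
    beta j p * (ex i p * ((s (s j) == i)%:R - (s j == i)%:R))).
Proof.
move=> Up; rewrite (eq_lder oU _ (@X_xE j) Up).
rewrite (lderD _ _ _ Up); [|exact: (smoothM oU (sa _) (smooth_ex oU _))
  |exact: (smoothM oU (sb _) (smooth_ex oU _))].
by rewrite (lderM _ (sa _) (smooth_ex oU _) Up) (lderM _ (sb _) (smooth_ex oU _) Up) !(Zd_ex oU).
Qed.

Lemma Zd_Xy i j p : U p -> Zd i (fun q => X q 0 (yidx j)) p =
  Zd i (alpha j) p * ey j p + alpha j p * (ey i p * ((s j == i)%:R - (j == i)%:R)) +
  (Zd i (beta j) p * ey (s j) p +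
    beta j p * (ey i p * ((s (s j) == i)%:R - (s j == i)%:R))).
Proof.
move=> Up; rewrite (eq_lder oU _ (@X_yE j) Up).
rewrite (lderD _ _ _ Up); [|exact: (smoothM oU (sa _) (smooth_ey oU _))
  |exact: (smoothM oU (sb _) (smooth_ey oU _))].
by rewrite (lderM _ (sa _) (smooth_ey oU _) Up) (lderM _ (sb _) (smooth_ey oU _) Up) !(Zd_ey oU).
Qed.

Lemma symmetry_cross i j p : U p ->
  ex j p * ((X p 0 (yidx (s i)) - X p 0 (yidx i)) * (j == i)%:R -
            Zd i (fun q => X q 0 (yidx j)) p) =
  ey j p * ((X p 0 (xidx (s i)) - X p 0 (xidx i)) * (j == i)%:R -
            Zd i (fun q => X q 0 (xidx j)) p).
Proof.
move=> Up; have [_ /(_ _ (antZ_section oU i))[_ /(_ p Up)]] := hX.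
move=> /antD_cross/(_ j); rewrite !(bracket_antZ oU)//.
by rewrite mul_tens_x mul_tens_y !sum_dZ.
Qed.

Local Notation Z i := (ldv (tens (dZ R i)) : V -> V).

Lemma Z_beta0 i : Z i (beta i) = alpha (s i) - beta i - beta (s i).
Proof.
apply: smooth_fun_eq => p Up; rewrite !smooth_funB ldvE//.
have := symmetry_cross i i Up; rewrite !Zd_Xx ?Zd_Xy// !X_xE// !X_yE//.
rewrite !ordS3_eqE !eqxx !ex_sum !ey_sum /= => H.
by apply: (mulfI (A0 Up)); rewrite -(areaE i p); lra.
Qed.

Lemma Z_beta1 i : Z i (beta (s i)) = beta (s i).
Proof.
apply: smooth_fun_eq => p Up; rewrite ldvE//.
have := symmetry_cross i (s i) Up; rewrite !Zd_Xx ?Zd_Xy//.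
rewrite !ordS3 !ordS3_eqE !eqxx !ex_sum !ey_sum /= => H.
by apply: (mulfI (A0 Up)); rewrite -(areaE i p); lra.
Qed.

Lemma Z_beta2 i : Z i (beta (s (s i))) = beta (s (s i)) - alpha (s (s i)).
Proof.
apply: smooth_fun_eq => p Up; rewrite smooth_funB ldvE//.
have := symmetry_cross i (s (s i)) Up; rewrite !Zd_Xx ?Zd_Xy//.
rewrite !ordS3 !ordS3_eqE !eqxx !ex_sum !ey_sum /= => H.
by apply: (mulfI (A0 Up)); rewrite -(areaE i p); lra.
Qed.
End SymmetryIsProjective.

Section TriangleModuleSmooth.
Variables (R : realType) (U : set 'rV[R]_6) (oU : open U).
Local Notation V := (smooth_fun oU).
Local Notation s := (@ordS 3).

Definition Zv i : {additive V -> V} := ldv (tens (dZ R i)).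
Definition Wv i : {additive V -> V} := ldv (tens (dW R i)).

Lemma ZZv i v : Zv i (Zv (s i) v) - Zv (s i) (Zv i v) = - Wv i v.
Proof. by rewrite ldv_comm !tensM -tensB comm_ZZ tensN ldv_oppl. Qed.
Lemma ZWv0 i v : Zv i (Wv i v) - Wv i (Zv i v) = Wv i v.
Proof. by rewrite ldv_comm !tensM -tensB comm_ZW0. Qed.
Lemma ZWv1 i v : Zv (s i) (Wv i v) - Wv i (Zv (s i) v) = - Wv i v.
Proof. by rewrite ldv_comm !tensM -tensB comm_ZW1 tensN ldv_oppl. Qed.
Lemma ZWv2 i v : Zv (s (s i)) (Wv i v) - Wv i (Zv (s (s i)) v) =
  - Zv i v - Wv i v + Wv (s (s i)) v + Zv (s (s i)) v.
Proof.
by rewrite ldv_comm !tensM -tensB comm_ZW2 3!tensD 2!tensN 3!ldv_addl 2!ldv_oppl.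
Qed.

Lemma smooth_fun_ev_inj (u v : V) :
  (forall p, smooth_fun_ev p u = smooth_fun_ev p v) -> u = v.
Proof. by move=> uv; apply: smooth_fun_eq => p _; exact: uv. Qed.

Hypothesis ncU : forall p, U p -> ~ collinear p.

Lemma Wv_eq0 (a : V) : (forall i, Zv i a = 0) -> forall i, Wv i a = 0.
Proof.
move=> Za i.
have ZZ0 j k : Zv j (Zv k a) = 0 := etrans (congr1 (Zv j) (Za k)) (raddf0 (Zv j)).
by rewrite -[LHS]opprK -[- Wv i a]ZZv (ZZ0 i (s i)) (ZZ0 (s i) i) subr0 oppr0.
Qed.

Lemma sum_dW (v : 'I_3 -> R) i k :
  \sum_l v l * dW R i l k = (v (s (s i)) - v (s i)) * (k == i)%:R.
Proof.
rewrite (big_ordS3 i) !mxE !ordS3_eqE !eqxx.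
by elim/(@ordS3_ind i): k; rewrite ?ordS3_eqE ?eqxx /=; ring.
Qed.

Lemma lder_tens (C : 'M[R]_3) f p : lder (tens C) f p =
  \sum_k ((\sum_l xc l p * C l k) * pderiv (xidx k) f p +
          (\sum_l yc l p * C l k) * pderiv (yidx k) f p).
Proof.
by rewrite /lder big_idx; apply: eq_bigr => k _; rewrite mul_tens_x mul_tens_y.
Qed.

Lemma lder_dZ i f p : lder (tens (dZ R i)) f p =
  ex i p * pderiv (xidx i) f p + ey i p * pderiv (yidx i) f p.
Proof.
have E (x y F G : 'I_3 -> R) :
    \sum_k ((\sum_l x l * dZ R i l k) * F k + (\sum_l y l * dZ R i l k) * G k) =
    (x (s i) - x i) * F i + (y (s i) - y i) * G i.
  by rewrite (big_ordS3 i) !sum_dZ eqxx !ordS3_eqE /=; ring.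
rewrite lder_tens.
exact: (E (fun l => xc l p) (fun l => yc l p) (fun k => pderiv (xidx k) f p)
          (fun k => pderiv (yidx k) f p)).
Qed.

Lemma lder_dW i f p : lder (tens (dW R i)) f p =
  ex (s i) p * pderiv (xidx i) f p + ey (s i) p * pderiv (yidx i) f p.
Proof.
have E (x y F G : 'I_3 -> R) :
    \sum_k ((\sum_l x l * dW R i l k) * F k + (\sum_l y l * dW R i l k) * G k) =
    (x (s (s i)) - x (s i)) * F i + (y (s (s i)) - y (s i)) * G i.
  by rewrite (big_ordS3 i) !sum_dW eqxx !ordS3_eqE /=; ring.
rewrite lder_tens.
exact: (E (fun l => xc l p) (fun l => yc l p) (fun k => pderiv (xidx k) f p)
          (fun k => pderiv (yidx k) f p)).
Qed.

Lemma cramer0 (a b c d u v : R) : a * d - c * b != 0 ->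
  a * u + b * v = 0 -> c * u + d * v = 0 -> u = 0 /\ v = 0.
Proof.
move=> det0 E1 E2; split; apply: (mulfI det0); rewrite mulr0.
  transitivity (d * (a * u + b * v) - b * (c * u + d * v)); first by ring.
  by rewrite E1 E2 !mulr0 subr0.
transitivity (a * (c * u + d * v) - c * (a * u + b * v)); first by ring.
by rewrite E1 E2 !mulr0 subr0.
Qed.

Lemma Zv_eq0_pderiv (v : V) : (forall i, Zv i v = 0) ->
  forall j p, U p -> pderiv j v p = 0.
Proof.
move=> Zv0 j p Up.
have A0 i : ex i p * ey (s i) p - ex (s i) p * ey i p != 0.
  by rewrite areaE; exact: area_neq0 (ncU Up).
have H i : pderiv (xidx i) v p = 0 /\ pderiv (yidx i) v p = 0.
  apply: (cramer0 (A0 i)).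
    by rewrite -lder_dZ -(ldvE _ v Up) (Zv0 i : ldv (tens (dZ R i)) v = 0).
  by rewrite -lder_dW -(ldvE _ v Up) (Wv_eq0 Zv0 i : ldv (tens (dW R i)) v = 0).
by elim/idx_ind: j => i; have [] := H i.
Qed.
End TriangleModuleSmooth.

Section Constancy.
Variables (R : realType) (U : set 'rV[R]_6) (oU : open U).
Hypothesis ncU : forall p, U p -> ~ collinear p.
Variable X : 'rV[R]_6 -> 'rV[R]_6.
Hypothesis hX : symmetries U (@antD R) X.
Local Notation s := (@ordS 3).
Local Notation V := (smooth_fun oU).
Local Notation a := (alpha oU ncU hX).
Local Notation b := (beta oU ncU hX).

Definition tau i : V := Zv oU i (a i) + b (s i).

Lemma symmetry_system i :
  [/\ Zv oU i (a (s i)) = b (s i), Zv oU i (a (s (s i))) = 0,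
      Zv oU i (tau i) = - tau i, Zv oU i (tau (s i)) = 0 &
      Zv oU i (tau (s (s i))) = tau i] /\
  tau i + tau (s i) + tau (s (s i)) = 0.
Proof.
refine (@triangle_system R V 'rV[R]_6 (fun p => smooth_fun_ev (oU:=oU) p)
  (@smooth_fun_ev_inj R U oU) _ s ordS3 (Zv oU) (Wv oU)
  (@ZZv R U oU) (@ZWv0 R U oU) (@ZWv1 R U oU) (@ZWv2 R U oU)
  a b (Z_beta0 oU ncU hX) (Z_beta1 oU ncU hX) (Z_beta2 oU ncU hX)
  tau (fun i => Zv oU i (a (s i)) - b (s i))
  (fun i => Zv oU i (a (s (s i)))) _ _ _ i) => // j.
  by rewrite addrK.
by rewrite subrK.
Qed.
End Constancy.

Section MatrixDerivative.
Variables (R : realType) (n : nat) (U : set 'rV[R]_n.+1).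
Hypothesis oU : open U.
Variables (m : nat) (M : 'M[R]_n.+1).
Implicit Types (F G : 'rV[R]_n.+1 -> 'M[R]_m) (p : 'rV[R]_n.+1).

Definition smooth_mx F := forall k l, smooth_on U (fun p => F p k l).
Definition lder_mx F p : 'M[R]_m := \matrix_(k, l) lder M (fun q => F q k l) p.

Lemma eq_lder_mx F G p : (forall q, U q -> F q = G q) -> U p ->
  lder_mx F p = lder_mx G p.
Proof.
move=> FG Up; apply/matrixP => k l; rewrite !mxE.
by apply: (eq_lder oU) => // q Uq; rewrite FG.
Qed.

Lemma smooth_mxM F G : smooth_mx F -> smooth_mx G ->
  smooth_mx (fun q => F q *m G q).
Proof.
move=> sF sG k l.
apply: (eq_smooth_on oU (f := fun q => \sum_j F q k j * G q j l)).
  by move=> q _; rewrite mxE.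
by apply: (smooth_sum oU) => j; apply: (smoothM oU).
Qed.

Lemma lder_mxM F G p : smooth_mx F -> smooth_mx G -> U p ->
  lder_mx (fun q => F q *m G q) p = lder_mx F p *m G p + F p *m lder_mx G p.
Proof.
move=> sF sG Up; apply/matrixP => k l; rewrite !mxE.
rewrite (eq_lder oU M (g := fun q => \sum_j F q k j * G q j l) _ Up); last first.
  by move=> q _; rewrite mxE.
rewrite (lder_sum M _ Up); last by move=> j; apply: (smoothM oU).
rewrite -big_split; apply: eq_bigr => j _ /=.
by rewrite (lderM M (sF k j) (sG j l) Up) !mxE.
Qed.

Lemma lder_mx_cst (C : 'M[R]_m) p : lder_mx (fun=> C) p = 0.
Proof. by apply/matrixP => k l; rewrite !mxE lder_cst. Qed.
End MatrixDerivative.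

Section HomogeneousCoordinates.
Variable R : realType.
Implicit Types (p : 'rV[R]_6).
Local Notation s := (@ordS 3).
Local Notation o := (@ord0 2).

Definition hmx p : 'M[R]_3 := \matrix_(k, j)
  if j == o then xc k p else if j == s o then yc k p else 1.

Definition hinv p : 'M[R]_3 := \matrix_(j, l)
  ((if j == o then - ey (s l) p else if j == s o then ex (s l) p
    else xc (s l) p * yc (s (s l)) p - xc (s (s l)) p * yc (s l) p) / area p).

Lemma hmx_hinv p : area p != 0 -> hmx p *m hinv p = 1%:M.
Proof.
move=> A0; apply/matrixP => k l; rewrite !mxE (big_ordS3 o) !mxE !ordS3_eqE !eqxx.
rewrite !mulrA -!mulrDl; apply: (mulIf A0); rewrite divfK// -(areaE l p) /ex /ey.
by elim/(@ordS3_ind l): k; rewrite ?eqxx ?ordS3_eqE ?ordS3 /=; ring.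
Qed.

Lemma hinv_hmx p : area p != 0 -> hinv p *m hmx p = 1%:M.
Proof. by move=> A0; apply: mulmx1C; exact: hmx_hinv. Qed.

Variable U : set 'rV[R]_6.
Hypothesis oU : open U.

Lemma smooth_hmx : smooth_mx U hmx.
Proof.
move=> k l; apply: (eq_smooth_on oU (f := fun p =>
  if l == o then xc k p else if l == s o then yc k p else 1)).
  by move=> p _; rewrite mxE.
by case: (l == o); [exact: smooth_xc|case: (l == s o); [exact: smooth_yc|exact: smooth_cst]].
Qed.

Lemma smooth_hinv : (forall p, U p -> area p != 0) -> smooth_mx U hinv.
Proof.
move=> A0 j l; apply: (eq_smooth_on oU (f := fun p =>
  ((if j == o then - ey (s l) p else if j == s o then ex (s l) p
    else xc (s l) p * yc (s (s l)) p - xc (s (s l)) p * yc (s l) p) / area p))).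
  by move=> p _; rewrite mxE.
apply: (smoothM oU); last exact: (smoothV oU A0 (smooth_area oU)).
case: (j == o); first by apply: (smoothN oU); exact: smooth_ey.
case: (j == s o); first exact: smooth_ex.
by apply: (smoothB oU); apply: (smoothM oU); (exact: smooth_xc || exact: smooth_yc).
Qed.

Lemma lder_hmx (C : 'M[R]_3) p : (forall k, \sum_l C l k = 0) -> U p ->
  lder_mx (tens C) hmx p = C^T *m hmx p.
Proof.
move=> C0 Up; apply/matrixP => k j; rewrite !mxE.
rewrite (eq_lder oU _ (g := fun q =>
  if j == o then xc k q else if j == s o then yc k q else 1) _ Up); last first.
  by move=> q _; rewrite mxE.
have [->|j0] := eqVneq j o.
  rewrite (lder_coord oU)// mul_tens_x; apply: eq_bigr => l _.
  by rewrite !mxE eqxx mulrC.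
have [->|j1] := eqVneq j (s o).
  rewrite (lder_coord oU)// mul_tens_y; apply: eq_bigr => l _.
  by rewrite !mxE !ordS3_eqE eqxx mulrC.
rewrite lder_cst -[LHS](C0 k); apply: eq_bigr => l _.
by rewrite !mxE (negPf j0) (negPf j1) mulr1.
Qed.
End HomogeneousCoordinates.

Section FrameMatrix.
Variables (R : realType) (U : set 'rV[R]_6) (oU : open U).
Local Notation s := (@ordS 3).
Local Notation V := (smooth_fun oU).
Variables a b t : 'I_3 -> V.

(* The matrix [3 B] of the header; the factor [3] keeps its entries in [V], where
   only sums are available. *)
Definition frame_mx (k l : 'I_3) : V :=
  if l == k then
    a k + a (s k) + a (s (s k)) - t k - t k - t (s k) - (a k + a k + a k)
  else if l == s k then (a k - b k) + (a k - b k) + (a k - b k)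
  else b k + b k + b k.

Lemma Zv_frame_mx i k l p :
  Zv oU i (a i) = t i - b (s i) -> Zv oU i (a (s i)) = b (s i) ->
  Zv oU i (a (s (s i))) = 0 -> Zv oU i (b i) = a (s i) - b i - b (s i) ->
  Zv oU i (b (s i)) = b (s i) ->
  Zv oU i (b (s (s i))) = b (s (s i)) - a (s (s i)) ->
  Zv oU i (t i) = - t i -> Zv oU i (t (s i)) = 0 ->
  Zv oU i (t (s (s i))) = t i -> t i + t (s i) + t (s (s i)) = 0 ->
  Zv oU i (frame_mx k l) p =
  (frame_mx (s i) l p - frame_mx i l p) * (k == i)%:R -
  frame_mx k i p * ((l == s i)%:R - (l == i)%:R).
Proof.
move=> Za0 Za1 Za2 Zb0 Zb1 Zb2 Zt0 Zt1 Zt2 /(congr1 (fun v : V => v p)).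
have v0 : (0 : V) p = 0 by [].
rewrite !smooth_funD v0 => S.
have zD := (raddfD (Zv oU i), raddfN (Zv oU i)).
elim/(@ordS3_ind i): k; elim/(@ordS3_ind i): l;
  rewrite /frame_mx ?ordS3 ?eqxx ?ordS3_eqE ?zD ?(Za0, Za1, Za2, Zb0, Zb1, Zb2, Zt0, Zt1, Zt2);
  rewrite ?(smooth_funD, smooth_funB, smooth_funN, v0) /=; lra.
Qed.
Lemma tr_frame_mx p : t ord0 + t (s ord0) + t (s (s ord0)) = 0 ->
  \sum_k frame_mx k k p = 0.
Proof.
move=> /(congr1 (fun v : V => v p)).
have v0 : (0 : V) p = 0 by [].
rewrite !smooth_funD v0 => S.
rewrite (big_ordS3 ord0) /frame_mx !eqxx !ordS3.
by rewrite !(smooth_funD, smooth_funB, smooth_funN); lra.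
Qed.

Lemma frame_mx_row p k (v : 'I_3 -> R) :
  \sum_l frame_mx k l p * v l - (\sum_l frame_mx k l p) * v k =
  3 * (a k p * (v (s k) - v k) + b k p * (v (s (s k)) - v (s k))).
Proof.
rewrite !(big_ordS3 k) /frame_mx eqxx !ordS3_eqE eqxx.
by rewrite !(smooth_funD, smooth_funB, smooth_funN); ring.
Qed.
End FrameMatrix.

Section SymmetryMatrix.
Variables (R : realType) (U : set 'rV[R]_6) (oU : open U).
Hypothesis ncU : forall p, U p -> ~ collinear p.
Variable X : 'rV[R]_6 -> 'rV[R]_6.
Hypothesis hX : symmetries U (@antD R) X.
Local Notation s := (@ordS 3).
Local Notation V := (smooth_fun oU).
Local Notation a := (alpha oU ncU hX).
Local Notation b := (beta oU ncU hX).
Local Notation t := (tau oU ncU hX).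

Let A0 p : U p -> area p != 0.
Proof. by move=> /ncU; exact: area_neq0. Qed.

Local Notation bv := (frame_mx a b t).

Definition bmx p : 'M[R]_3 := \matrix_(k, l) bv k l p.

Lemma smooth_bmx : smooth_mx U bmx.
Proof.
move=> k l; apply: (eq_smooth_on oU _ (smooth_funP (bv k l))).
by move=> p _; rewrite mxE.
Qed.

Lemma Zv_bv i k l p : Zv oU i (bv k l) p =
  (bv (s i) l p - bv i l p) * (k == i)%:R -
  bv k i p * ((l == s i)%:R - (l == i)%:R).
Proof.
have [[Za1 Za2 Zt0 Zt1 Zt2] S] := symmetry_system oU ncU hX i.
apply: Zv_frame_mx => //; first by rewrite addrK.
- exact: Z_beta0.
- exact: Z_beta1.
- exact: Z_beta2.
Qed.

Lemma lder_bmx i p : U p -> lder_mx (tens (dZ R i)) bmx p =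
  (dZ R i)^T *m bmx p - bmx p *m (dZ R i)^T.
Proof.
move=> Up; apply/matrixP => k l.
have E1 : ((dZ R i)^T *m bmx p) k l = (bmx p (s i) l - bmx p i l) * (k == i)%:R.
  rewrite -(sum_dZ (fun m => bmx p m l)) mxE; apply: eq_bigr => m _.
  by rewrite [in LHS]mxE mulrC.
have E2 : (bmx p *m (dZ R i)^T) k l = bmx p k i * ((l == s i)%:R - (l == i)%:R).
  rewrite mxE (big_ordS3 i); rewrite !(mxE _ _ _ l) !mxE !ordS3_eqE eqxx !andbT !andbF /=.
  by rewrite subr0 !mulr0 !addr0.
rewrite [RHS]mxE E1 [X in _ = _ + X]mxE E2 !mxE -Zv_bv ldvE//.
by apply: (eq_lder oU) => // q _; rewrite mxE.
Qed.

Definition amx p : 'M[R]_3 := hinv p *m bmx p *m hmx p.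

Lemma lder_amx i p : U p -> lder_mx (tens (dZ R i)) amx p = 0.
Proof.
move=> Up; set M := tens (dZ R i); set N := (dZ R i)^T.
have sP := smooth_hmx oU; have sQ := smooth_hinv oU A0.
have sB := smooth_bmx; have sQB := smooth_mxM oU sQ sB.
have dZ0 k : \sum_l dZ R i l k = 0.
  transitivity (\sum_l (fun=> 1 : R) l * dZ R i l k).
    by apply: eq_bigr => l _; rewrite mul1r.
  by rewrite sum_dZ subrr mul0r.
have ZP : lder_mx M (@hmx R) p = N *m hmx p by exact: (lder_hmx oU).
have ZQ : lder_mx M (@hinv R) p = - (hinv p *m N).
  have : lder_mx M (fun q => hinv q *m hmx q) p = 0.
    by rewrite (eq_lder_mx oU M (G := fun=> 1%:M) _ Up) ?lder_mx_cst// => q Uq;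
       apply: hinv_hmx; exact: A0.
  rewrite (lder_mxM oU M sQ sP Up) ZP mulmxA => /(congr1 (fun C => C *m hinv p)).
  rewrite mul0mx mulmxDl -!mulmxA hmx_hinv ?A0// !mulmx1 => /eqP.
  by rewrite addr_eq0 => /eqP.
rewrite (lder_mxM oU M sQB sP Up) (lder_mxM oU M sQ sB Up) ZP ZQ lder_bmx//.
rewrite -/N mulmxBr !mulmxDl !mulNmx !mulmxA.
by rewrite addrA addNr add0r addNr.
Qed.

Lemma amx_const : connected U -> forall p q, U p -> U q -> amx p = amx q.
Proof.
move=> cU p q Up Uq; apply/matrixP => k l.
have sA : smooth_on U (fun p => amx p k l).
  apply: (smooth_mxM oU _ (smooth_hmx oU)).
  by apply: (smooth_mxM oU (smooth_hinv oU A0)); exact: smooth_bmx.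
pose v : V := smooth_restrict oU sA.
have vE x : U x -> v x = amx x k l by exact: smooth_restrictE.
rewrite -!vE//; apply: (pderiv0_const oU cU (smooth_funP v)) => // j x Ux.
apply: (Zv_eq0_pderiv ncU) => // i; apply: smooth_fun_eq => y Uy.
rewrite ldvE// (eq_lder oU _ vE Uy).
by have := congr1 (fun C : 'M[R]_3 => C k l) (lder_amx i Uy); rewrite !mxE.
Qed.

Lemma bmx_amx p : U p -> hmx p *m amx p = bmx p *m hmx p.
Proof.
by move=> Up; rewrite /amx !mulmxA hmx_hinv ?mul1mx//; exact: A0.
Qed.

Lemma tr_amx p : U p -> \tr (amx p) = 0.
Proof.
move=> Up; rewrite /amx mxtrace_mulC mulmxA hmx_hinv ?A0// mul1mx.
have [_ S] := symmetry_system oU ncU hX ord0.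
by rewrite -[RHS](tr_frame_mx a b p S); apply: eq_bigr => k _; rewrite mxE.
Qed.

Lemma X_amx_x k p : U p -> 3 * X p 0 (xidx k) =
  (hmx p *m amx p) k ord0 - (hmx p *m amx p) k (s (s ord0)) * xc k p.
Proof.
move=> Up; rewrite bmx_amx// (X_xE oU ncU hX)// -(frame_mx_row a b t p k (fun l => xc l p)).
congr (_ - _ * _); rewrite mxE; apply: eq_bigr => l _; rewrite !mxE ?eqxx//.
by rewrite !ordS3_eqE mulr1.
Qed.

Lemma X_amx_y k p : U p -> 3 * X p 0 (yidx k) =
  (hmx p *m amx p) k (s ord0) - (hmx p *m amx p) k (s (s ord0)) * yc k p.
Proof.
move=> Up; rewrite bmx_amx// (X_yE oU ncU hX)// -(frame_mx_row a b t p k (fun l => yc l p)).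
by congr (_ - _ * _); rewrite mxE; apply: eq_bigr => l _; rewrite !mxE !ordS3_eqE ?eqxx ?mulr1.
Qed.
End SymmetryMatrix.

(** * Projective vector fields *)

Section ProjectiveFields.
Variable R : realType.
Implicit Types (p : 'rV[R]_6) (A B : 'M[R]_3).
Local Notation s := (@ordS 3).
Local Notation o0 := (@ord0 2).
Local Notation o1 := (s o0).
Local Notation o2 := (s o1).

Definition quad (c0 c1 c2 c3 c4 c5 x y : R) : R :=
  c0 + c1 * x + c2 * y + c3 * (x * x) + c4 * (x * y) + c5 * (y * y).

Lemma smooth_quad (U : set 'rV[R]_6) c0 c1 c2 c3 c4 c5 i : open U ->
  smooth_on U (fun p => quad c0 c1 c2 c3 c4 c5 (xc i p) (yc i p)).
Proof.
move=> oU; rewrite /quad; have sx := smooth_xc oU i; have sy := smooth_yc oU i.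
by repeat (apply: (smoothD oU) || apply: (smoothM oU) || exact: (smooth_cst oU)
  || exact: sx || exact: sy).
Qed.

Lemma pderiv_quad c0 c1 c2 c3 c4 c5 i j p :
  pderiv j (fun p => quad c0 c1 c2 c3 c4 c5 (xc i p) (yc i p)) p =
  (c1 + 2 * c3 * xc i p + c4 * yc i p) * (xidx i == j)%:R +
  (c2 + c4 * xc i p + 2 * c5 * yc i p) * (yidx i == j)%:R.
Proof.
have oT : open [set: 'rV[R]_6] by exact: openT.
have sx := smooth_xc oT i; have sy := smooth_yc oT i.
have d f : smooth_on setT f -> derivable f p (delta_mx 0 j).
  by move=> sf; exact: smooth_derivable sf _.
have dD f g : smooth_on setT f -> smooth_on setT g ->
    pderiv j (fun q => f q + g q) p = pderiv j f p + pderiv j g p.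
  by move=> sf sg; apply: pderivD; exact: d.
have dM f g : smooth_on setT f -> smooth_on setT g ->
    pderiv j (fun q => f q * g q) p = pderiv j f p * g p + f p * pderiv j g p.
  by move=> sf sg; apply: pderivM; exact: d.
have dc (c : R) : pderiv j (fun=> c) p = 0 by rewrite /pderiv derive_cst.
have dx : pderiv j (@xc R i) p = (xidx i == j)%:R by have [] := pderiv_coord j (xidx i) p.
have dy : pderiv j (@yc R i) p = (yidx i == j)%:R by have [] := pderiv_coord j (yidx i) p.
rewrite /quad !dD; try by repeat (apply: (smoothD oT) || apply: (smoothM oT)
  || exact: (smooth_cst oT) || exact: sx || exact: sy).
rewrite !dM; try by repeat (apply: (smoothD oT) || apply: (smoothM oT)
  || exact: (smooth_cst oT) || exact: sx || exact: sy).
by rewrite !dc dx dy; ring.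
Qed.

Definition projx A (x y : R) : R :=
  quad (A o2 o0) (A o0 o0 - A o2 o2) (A o1 o0) (- A o0 o2) (- A o1 o2) 0 x y.
Definition projy A (x y : R) : R :=
  quad (A o2 o1) (A o0 o1) (A o1 o1 - A o2 o2) 0 (- A o0 o2) (- A o1 o2) x y.

Definition psi A p : 'rV[R]_6 :=
  \sum_i (projx A (xc i p) (yc i p) *: dx i + projy A (xc i p) (yc i p) *: dy i).

Lemma psi_x A p i : psi A p 0 (xidx i) = projx A (xc i p) (yc i p).
Proof.
rewrite summxE (big_ordS3 i) !mxE ?eqxx ?idxE ?ordS3_eqE ?eqxx /=; ring.
Qed.
Lemma psi_y A p i : psi A p 0 (yidx i) = projy A (xc i p) (yc i p).
Proof.
rewrite summxE (big_ordS3 i) !mxE ?eqxx ?idxE ?ordS3_eqE ?eqxx /=; ring.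
Qed.

Lemma projx_hmx A p i : projx A (xc i p) (yc i p) =
  (hmx p *m A) i o0 - (hmx p *m A) i o2 * xc i p.
Proof.
by rewrite !mxE !(big_ordS3 o0) !mxE !ordS3_eqE !eqxx /projx /quad; ring.
Qed.
Lemma projy_hmx A p i : projy A (xc i p) (yc i p) =
  (hmx p *m A) i o1 - (hmx p *m A) i o2 * yc i p.
Proof.
by rewrite !mxE !(big_ordS3 o0) !mxE !ordS3_eqE !eqxx /projy /quad; ring.
Qed.

Lemma psi_linear a A B p : psi (a *: A + B) p = a *: psi A p + psi B p.
Proof.
apply/rowP; elim/idx_ind => i; rewrite [RHS]mxE [in RHS]mxE ?psi_x ?psi_y.
  by rewrite /projx /quad !mxE; ring.
by rewrite /projy /quad !mxE; ring.
Qed.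

Lemma sum_quad (v : 'I_6 -> R) (c d : R) i :
  \sum_k v k * (c * (xidx i == k)%:R + d * (yidx i == k)%:R) =
  c * v (xidx i) + d * v (yidx i).
Proof. by rewrite big_idx (big_ordS3 i) !idxE !ordS3_eqE eqxx /=; ring. Qed.

Variable U : set 'rV[R]_6.
Hypothesis oU : open U.

Lemma smooth_psi A j : smooth_on U (fun p => psi A p 0 j).
Proof.
elim/idx_ind: j => i.
  apply: (eq_smooth_on oU _ (smooth_quad _ _ _ _ _ _ i oU)) => p _.
  by rewrite psi_x.
apply: (eq_smooth_on oU _ (smooth_quad _ _ _ _ _ _ i oU)) => p _.
by rewrite psi_y.
Qed.

Definition psiU A := vf_restrict U (psi A).

Lemma psiU_linear a A B : psiU (a *: A + B) = a *: psiU A + psiU B.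
Proof.
apply/funext => p; rewrite !fctE.
have [Up|Up] := pselect (U p); first by rewrite /psiU !vf_restrictE// psi_linear.
by rewrite /psiU !vf_restrict_out// scaler0 addr0.
Qed.

Lemma pderiv_psix A i j p : U p -> pderiv j (fun q => psiU A q 0 (xidx i)) p =
  (A o0 o0 - A o2 o2 + 2 * (- A o0 o2) * xc i p + (- A o1 o2) * yc i p) * (xidx i == j)%:R +
  (A o1 o0 + (- A o1 o2) * xc i p + 2 * 0 * yc i p) * (yidx i == j)%:R.
Proof.
move=> Up; rewrite -(pderiv_quad (A o2 o0)); apply: (eq_pderiv oU) => // q Uq.
by rewrite /psiU vf_restrictE// psi_x.
Qed.

Lemma pderiv_psiy A i j p : U p -> pderiv j (fun q => psiU A q 0 (yidx i)) p =
  (A o0 o1 + 2 * 0 * xc i p + (- A o0 o2) * yc i p) * (xidx i == j)%:R +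
  (A o1 o1 - A o2 o2 + (- A o0 o2) * xc i p + 2 * (- A o1 o2) * yc i p) * (yidx i == j)%:R.
Proof.
move=> Up; rewrite -(pderiv_quad (A o2 o1)); apply: (eq_pderiv oU) => // q Uq.
by rewrite /psiU vf_restrictE// psi_y.
Qed.

Lemma psiU_bracket A B : vf_bracket U (psiU A) (psiU B) = psiU (mx_bracket A B).
Proof.
apply/funext => p; have [Up|Up] := pselect (U p); last first.
  by rewrite /vf_bracket /psiU !vf_restrict_out.
rewrite /vf_bracket vf_restrictE//; apply/rowP; elim/idx_ind => i; rewrite mxE sumrB.
- under eq_bigr => k _ do rewrite pderiv_psix//.
  under [X in _ - X]eq_bigr => k _ do rewrite pderiv_psix//.
  rewrite !sum_quad /psiU !vf_restrictE// !psi_x !psi_y.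
  by rewrite /projx /projy /quad /mx_bracket !mxE !(big_ordS3 o0); ring.
- under eq_bigr => k _ do rewrite pderiv_psiy//.
  under [X in _ - X]eq_bigr => k _ do rewrite pderiv_psiy//.
  rewrite !sum_quad /psiU !vf_restrictE// !psi_x !psi_y.
  by rewrite /projx /projy /quad /mx_bracket !mxE !(big_ordS3 o0); ring.
Qed.

End ProjectiveFields.

Lemma vector_field_bracket (R : realType) (n : nat) (U : set 'rV[R]_n.+1)
    (X Y : 'rV[R]_n.+1 -> 'rV[R]_n.+1) : open U ->
  vector_field U X -> vector_field U Y -> vector_field U (vf_bracket U X Y).
Proof.
move=> oU [sX _] [sY _]; apply: (vector_field_restrict oU) => j.
apply: (eq_smooth_on oU (f := fun p => \sum_i
    (X p 0 i * pderiv i (fun q => Y q 0 j) p -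
     Y p 0 i * pderiv i (fun q => X q 0 j) p))).
  by move=> p _; rewrite mxE.
apply: (smooth_sum oU) => i.
by apply: (smoothB oU); apply: (smoothM oU) => //; exact: smooth_pderiv.
Qed.

Section Classification.
Variables (R : realType) (U : set 'rV[R]_6).
Hypothesis oU : open U.
Hypothesis ncU : forall p, U p -> ~ collinear p.
Implicit Types (p : 'rV[R]_6) (A B : 'M[R]_3) (X : 'rV[R]_6 -> 'rV[R]_6).
Local Notation s := (@ordS 3).
Local Notation o0 := (@ord0 2).
Local Notation o1 := (s o0).
Local Notation o2 := (s o1).
Local Notation L := (symmetries U (@antD R)).

Let A0 p : U p -> area p != 0.
Proof. by move=> /ncU; exact: area_neq0. Qed.

Lemma cross_parallel j p (u v : R) : area p != 0 -> ex j p * v = ey j p * u ->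
  exists c, u = c * ex j p /\ v = c * ey j p.
Proof.
move=> Ap E; exists ((u * ey (s j) p - v * ex (s j) p) / area p).
split; apply: (mulIf Ap); rewrite mulrAC divfK// -(areaE j p).
  by have := congr1 ( *%R (ex (s j) p)) E; lra.
by have := congr1 ( *%R (ey (s j) p)) E; lra.
Qed.

(* [Z] is a section of the distribution when [d_j x Z_j = 0]; differentiate
   this identity along the field. *)
Lemma psiU_symmetry A : L (psiU U A).
Proof.
have vA : vector_field U (psiU U A).
  by apply: (vector_field_restrict oU) => j; exact: smooth_psi.
split=> // Z [vZ DZ]; split; first exact: vector_field_bracket.
move=> p Up; apply: cross_antD => [|j]; first exact: A0.
have [sZ _] := vZ.
pose D f := \sum_k psiU U A p 0 k * pderiv k f p.
have brE l : vf_bracket U (psiU U A) Z p 0 l = D (fun q => Z q 0 l) -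
    \sum_k Z p 0 k * pderiv k (fun q => psiU U A q 0 l) p.
  by rewrite /vf_bracket vf_restrictE// mxE sumrB.
have Dcoord l : D (fun q => q 0 l) = psiU U A p 0 l.
  rewrite /D (bigD1 l)//= big1 ?addr0 => [|k kl].
    by rewrite (pderiv_coord _ _ _).2 eqxx mulr1.
  by rewrite (pderiv_coord _ _ _).2 eq_sym (negPf kl) mulr0.
have DB f g : smooth_on U f -> smooth_on U g -> D (fun q => f q - g q) = D f - D g.
  move=> sf sg; rewrite /D -sumrB; apply: eq_bigr => k _.
  rewrite -mulrBr; congr (_ * _); rewrite -pderivN; last exact: smooth_derivable sg Up.
  rewrite -pderivD//; first exact: smooth_derivable sf Up.
  by apply: derivableN; exact: smooth_derivable sg Up.
have DM f g : smooth_on U f -> smooth_on U g ->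
    D (fun q => f q * g q) = D f * g p + f p * D g.
  move=> sf sg; rewrite /D mulr_suml mulr_sumr -big_split; apply: eq_bigr => k _ /=.
  by rewrite pderivM; [ring|exact: smooth_derivable sf Up|exact: smooth_derivable sg Up].
have H : D (fun q => ex j q * Z q 0 (yidx j) - ey j q * Z q 0 (xidx j)) = 0.
  rewrite /D big1// => k _; rewrite (eq_pderiv oU k (g := fun=> 0) _ Up).
    by rewrite /pderiv derive_cst mulr0.
  by move=> q Uq; rewrite (antD_cross (DZ q Uq)) subrr.
have sex := smooth_ex oU j; have sey := smooth_ey oU j.
move: H; rewrite DB; [|exact: (smoothM oU)|exact: (smoothM oU)].
rewrite !DM// !DB; try exact: smooth_xc; try exact: smooth_yc.
rewrite !Dcoord !brE.
under [X in ex j p * (_ - X)]eq_bigr => k _ do rewrite pderiv_psiy//.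
under [X in ey j p * (_ - X)]eq_bigr => k _ do rewrite pderiv_psix//.
rewrite !sum_quad /psiU !vf_restrictE// !psi_x !psi_y.
have [c [-> ->]] := cross_parallel (A0 Up) (antD_cross (DZ p Up) j).
rewrite /projx /projy /quad /ex /ey; lra.
Qed.

Lemma symmetry_psiU X : connected U -> U !=set0 -> L X ->
  exists2 A, \tr A = 0 & X = psiU U A.
Proof.
move=> cU [p0 Up0] hX; exists (3^-1 *: amx oU ncU hX p0).
  by rewrite mxtraceZ tr_amx// mulr0.
apply/funext => p; have [Up|Up] := pselect (U p); last first.
  by rewrite (vector_field_out hX.1 Up) /psiU vf_restrict_out.
rewrite /psiU vf_restrictE//; apply/rowP.
have n3 : (3 : R) != 0 by rewrite pnatr_eq0.
elim/idx_ind => k; apply: (mulfI n3).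
  rewrite (X_amx_x oU ncU hX k Up) psi_x projx_hmx -scalemxAr !mxE.
  by rewrite (amx_const oU ncU hX cU Up Up0); field.
rewrite (X_amx_y oU ncU hX k Up) psi_y projy_hmx -scalemxAr !mxE.
by rewrite (amx_const oU ncU hX cU Up Up0); field.
Qed.

(* Second differences of a quadratic field on a small cross around a point of
   [U] recover all coefficients. *)
Lemma psiU_inj0 A : U !=set0 -> \tr A = 0 -> psiU U A = 0 -> A = 0.
Proof.
move=> [p Up] trA A_0.
have /nbhs_ballP[e /= e0 Be] : nbhs p U by exact: open_nbhs_nbhs.
pose h := e / 2; have h0 : 0 < h by rewrite divr_gt0.
have P (u v : R) : `|u| <= h -> `|v| <= h ->
    projx A (xc o0 p + u) (yc o0 p + v) = 0 /\ projy A (xc o0 p + u) (yc o0 p + v) = 0.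
  move=> uh vh; pose q := p + (u *: dx o0 + v *: dy o0).
  have qx : xc o0 q = xc o0 p + u.
    by rewrite /xc /q !mxE !eqxx !idxE /=; ring.
  have qy : yc o0 q = yc o0 p + v.
    by rewrite /yc /q !mxE !eqxx !idxE /=; ring.
  have Uq : U q.
    apply: Be; split=> // a b; rewrite /ball /= /q !mxE (ord1 a) !eqxx /=.
    have he : h < e by rewrite /h; lra.
    elim/idx_ind: b => b; rewrite !idxE /= ?mulr0 ?addr0 ?add0r opprD addNKr normrN.
      by case: (b == o0); rewrite ?mulr1 ?mulr0 ?normr0// (le_lt_trans uh).
    by case: (b == o0); rewrite ?mulr1 ?mulr0 ?normr0// (le_lt_trans vh).
  have E : psi A q = 0.
    by have := congr1 (fun F => F q) A_0; rewrite /psiU /= vf_restrictE.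
  by rewrite -qx -qy -psi_x -psi_y E !mxE.
have n0 : `|0 : R| <= h by rewrite normr0 ltW.
have nh : `|h| <= h by rewrite gtr0_norm.
have nNh : `|- h| <= h by rewrite normrN gtr0_norm.
have [X00 Y00] := P 0 0 n0 n0.
have [Xp0 Yp0] := P h 0 nh n0; have [Xm0 Ym0] := P (- h) 0 nNh n0.
have [X0p Y0p] := P 0 h n0 nh; have [X0m Y0m] := P 0 (- h) n0 nNh.
have hh : h * h != 0 by rewrite mulf_neq0 ?gt_eqF.
have hn : h != 0 by rewrite gt_eqF.
move: X00 Y00 Xp0 Yp0 Xm0 Ym0 X0p Y0p X0m Y0m; rewrite /projx /projy /quad.
set x := xc o0 p; set y := yc o0 p => X00 Y00 Xp0 Yp0 Xm0 Ym0 X0p Y0p X0m Y0m.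
have a02 : A o0 o2 = 0 by apply: (mulfI hh); rewrite mulr0; lra.
have a12 : A o1 o2 = 0 by apply: (mulfI hh); rewrite mulr0; lra.
rewrite !a02 !a12 in X00 Y00 Xp0 Yp0 Xm0 Ym0 X0p Y0p X0m Y0m.
have a00 : A o0 o0 - A o2 o2 = 0 by apply: (mulfI hn); rewrite mulr0; lra.
have a10 : A o1 o0 = 0 by apply: (mulfI hn); rewrite mulr0; lra.
have a01 : A o0 o1 = 0 by apply: (mulfI hn); rewrite mulr0; lra.
have a11 : A o1 o1 - A o2 o2 = 0 by apply: (mulfI hn); rewrite mulr0; lra.
rewrite !a00 !a10 in X00; rewrite !a01 !a11 in Y00.
have a20 : A o2 o0 = 0 by lra.
have a21 : A o2 o1 = 0 by lra.
move: trA; rewrite /mxtrace (big_ordS3 o0) => trA.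
apply/matrixP => i j; rewrite mxE.
by elim/(@ordS3_ind o0): i; elim/(@ordS3_ind o0): j => //; lra.
Qed.

End Classification.

(** * The basis and the isomorphism *)

Section Basis.
Variables (R : realType) (U : set 'rV[R]_6).
Local Notation s := (@ordS 3).
Local Notation o0 := (@ord0 2).
Local Notation o1 := (s o0).
Local Notation o2 := (s o1).

Lemma big_ord8 (V : nmodType) (F : 'I_8 -> V) : \sum_k F k =
  F (inord 0) + F (inord 1) + F (inord 2) + F (inord 3) +
  F (inord 4) + F (inord 5) + F (inord 6) + F (inord 7).
Proof.
transitivity (\sum_(0 <= k < 8) F (inord k)).
  by rewrite big_mkord; apply: eq_bigr => k _; rewrite inord_val.
by rewrite !big_nat_recl// big_geq// addr0 !addrA.
Qed.

Definition sl3_mx (c : 'I_8 -> R) : 'M[R]_3 :=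
  let z := - (c (inord 4) + c (inord 5)) / 3 in
  \matrix_(i, j)
    if i == o0 then
      if j == o0 then c (inord 4) + z else if j == o1 then c (inord 3) else - c (inord 7)
    else if i == o1 then
      if j == o0 then c (inord 2) else if j == o1 then c (inord 5) + z else - c (inord 6)
    else if j == o0 then c (inord 0) else if j == o1 then c (inord 1) else z.

Lemma tr_sl3_mx c : \tr (sl3_mx c) = 0.
Proof.
by rewrite /mxtrace (big_ordS3 o0) !mxE !ordS3_eqE !eqxx; field.
Qed.

Lemma sl3_mx_eq0 c : sl3_mx c = 0 -> forall k, c k = 0.
Proof.
move=> /matrixP E k.
have := (E o0 o0, E o0 o1, E o0 o2, E o1 o0, E o1 o1, E o1 o2, E o2 o0, E o2 o1, E o2 o2).
rewrite !mxE !ordS3_eqE !eqxx => -[[[[[[[[e00 e01] e02] e10] e11] e12] e20] e21] e22].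
rewrite -(inord_val k); case: k => -[|[|[|[|[|[|[|[|]]]]]]]]//= _; lra.
Qed.

Lemma sl3_mx_surj (A : 'M[R]_3) : \tr A = 0 -> exists c, A = sl3_mx c.
Proof.
move=> trA; pose c := nth 0 [:: A o2 o0; A o2 o1; A o1 o0; A o0 o1;
  A o0 o0 - A o2 o2; A o1 o1 - A o2 o2; - A o1 o2; - A o0 o2].
exists (fun k => c k); apply/matrixP => i j; rewrite !mxE !inordK// /c /=.
move: trA; rewrite /mxtrace (big_ordS3 o0) => trA.
by elim/(@ordS3_ind o0): i; elim/(@ordS3_ind o0): j; rewrite ?eqxx ?ordS3_eqE; lra.
Qed.

Lemma antX_inord m : (m < 8)%N -> @antX R (inord m) =
  nth (@antX1 R) [:: @antX1 R; @antX2 R; @antX3 R; @antX4 R;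
                     @antX5 R; @antX6 R; @antX7 R; @antX8 R] m.
Proof. by move=> m8; rewrite /antX (tnth_nth (@antX1 R)) /= inordK. Qed.

Lemma sum_antX (c : 'I_8 -> R) p : \sum_k c k *: antX k p = psi (sl3_mx c) p.
Proof.
rewrite big_ord8 !antX_inord//=.
apply/rowP; elim/idx_ind => i; rewrite ?psi_x ?psi_y !mxE.
- rewrite /antX1 /antX2 /antX3 /antX4 /antX5 /antX6 /antX7 /antX8.
  rewrite ?mxE !summxE !(big_ordS3 i) !mxE !idxE !ordS3_eqE ?eqxx.
  by rewrite /projx /quad !mxE !ordS3_eqE !eqxx /=; field.
- rewrite /antX1 /antX2 /antX3 /antX4 /antX5 /antX6 /antX7 /antX8.
  rewrite ?mxE !summxE !(big_ordS3 i) !mxE !idxE !ordS3_eqE ?eqxx.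
  by rewrite /projy /quad !mxE !ordS3_eqE !eqxx /=; field.
Qed.

Lemma sum_restrict_antX (c : 'I_8 -> R) :
  \sum_k c k *: vf_restrict U (antX k) = psiU U (sl3_mx c).
Proof.
apply/funext => p; rewrite fct_sumE.
have [Up|Up] := pselect (U p).
  rewrite /psiU vf_restrictE// -sum_antX; apply: eq_bigr => k _.
  by rewrite !fctE vf_restrictE.
rewrite /psiU vf_restrict_out// big1// => k _.
by rewrite !fctE vf_restrict_out// scaler0.
Qed.
End Basis.

Lemma mx_bracket_jacobi (R : fieldType) (n : nat) (A B C : 'M[R]_n) :
  mx_bracket A (mx_bracket B C) + mx_bracket B (mx_bracket C A) +
  mx_bracket C (mx_bracket A B) = 0.
Proof.
rewrite /mx_bracket !(mulmxBl, mulmxBr) !mulmxA; apply/matrixP => i j.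
by rewrite !mxE; ring.
Qed.

Lemma tr_mx_bracket (R : fieldType) (n : nat) (A B : 'M[R]_n) :
  \tr (mx_bracket A B) = 0.
Proof. by rewrite /mx_bracket raddfB /= mxtrace_mulC subrr. Qed.

Theorem theorem2p1 (R : realType) (U : set 'rV[R]_6) :
  open U -> connected U -> U !=set0 ->
  (forall p : 'rV[R]_6, U p -> ~ collinear p) ->
  [/\ is_lie_algebra (symmetries U (@antD R)) (vf_bracket U),
      lie_isomorphic (symmetries U (@antD R)) (vf_bracket U)
                     (@sl R 3) (@mx_bracket R 3) &
      is_basis (symmetries U (@antD R)) (fun k : 'I_8 => vf_restrict U (antX k))].
Proof.
move=> oU cU U0 ncU.
have symP X : symmetries U (@antD R) X -> exists2 A, \tr A = 0 & X = psiU U A.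
  exact: symmetry_psiU.
have psiP A : symmetries U (@antD R) (psiU U A) by exact: psiU_symmetry.
have psi_lin a A B := psiU_linear U a A B.
have psi_0 : psiU U (0 : 'M[R]_3) = 0.
  by have := psi_lin (-1) 0 0; rewrite scaler0 addr0 scaleN1r addNr.
have psi_add A B : psiU U (A + B) = psiU U A + psiU U B.
  by rewrite -{1}[A]scale1r psi_lin scale1r.
have psi_br A B := psiU_bracket oU A B.
have psi_inj A B : \tr A = 0 -> \tr B = 0 -> psiU U A = psiU U B -> A = B.
  move=> trA trB AB; apply/eqP; rewrite -subr_eq0; apply/eqP.
  apply: (psiU_inj0 oU U0); first by rewrite raddfB /= trA trB subrr.
  by rewrite addrC -scaleN1r psi_lin AB scaleN1r addNr.
split.
- split.
  + split; first by rewrite -psi_0.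
    by move=> a _ _ /symP[A _ ->] /symP[B _ ->]; rewrite -psi_lin.
  + by move=> _ _ /symP[A _ ->] /symP[B _ ->]; rewrite psi_br.
  + move=> a _ _ _ /symP[A _ ->] /symP[B _ ->] /symP[C _ ->].
    rewrite -psi_lin !psi_br -!psi_lin /mx_bracket; split; congr (psiU U _).
      by rewrite mulmxDl mulmxDr -scalemxAl -scalemxAr scalerBr opprD addrACA.
    by rewrite mulmxDl mulmxDr -scalemxAl -scalemxAr scalerBr opprD addrACA.
  + by move=> _ /symP[A _ ->]; rewrite psi_br /mx_bracket subrr psi_0.
  + move=> _ _ _ /symP[A _ ->] /symP[B _ ->] /symP[C _ ->].
    by rewrite !psi_br -!psi_add mx_bracket_jacobi psi_0.
- pose phi X := xget 0 [set A : 'M[R]_3 | \tr A = 0 /\ psiU U A = X].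
  have phiK A : \tr A = 0 -> phi (psiU U A) = A.
    move=> trA; rewrite /phi; case: xgetP => [B _ [trB /psi_inj->//]|].
    by move=> /(_ A)[].
  exists phi; split.
  + split.
    * by move=> _ /symP[A trA ->]; rewrite phiK.
    * move=> X Y /[!inE] /symP[A trA ->] /symP[B trB ->].
      by rewrite !phiK// => ->.
    * by move=> A trA; exists (psiU U A) => //; rewrite phiK.
  + move=> a _ _ /symP[A trA ->] /symP[B trB ->].
    by rewrite -psi_lin !phiK// mxtraceD mxtraceZ trA trB mulr0 addr0.
  + move=> _ _ /symP[A trA ->] /symP[B trB ->].
    by rewrite psi_br !phiK// tr_mx_bracket.
- split.
  + move=> k; have := psiP (sl3_mx (fun j => (j == k)%:R)).
    rewrite -sum_restrict_antX (bigD1 k)//= eqxx scale1r big1 ?addr0// => j /negPf->.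
    by rewrite scale0r.
  + move=> c; rewrite sum_restrict_antX => c0; apply: sl3_mx_eq0.
    by apply: (psiU_inj0 oU U0) => //; exact: tr_sl3_mx.
  + move=> _ /symP[A trA ->]; have [c ->] := sl3_mx_surj trA.
    by exists c; rewrite sum_restrict_antX.
Qed.
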